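(* Let $G$ be a planar graph with $\sigma=\sigma(G)\ge 5$, $\sigma\ge\Delta(G)+2$ and girth at least $g_\sigma$, where $$g_\sigma=\begin{cases}41, & \text{if } \sigma=5;\\ 36, & \text{if } \sigma=6,7;\\ 5\sigma+1, & \text{if } \sigma\ge 8.\end{cases}$$ Then $\chi'_s(G)=\sigma$.
   Context: Graphs are finite and simple, and $\Delta(G)$ is the maximum degree. The girth is the length of a shortest cycle ($+\infty$ if there is none). A strong $k$-edge-coloring of $G$ is a map $E(G)\to\{1,\dots,k\}$ such that any two distinct edges at distance at most two (that is, sharing an endpoint, or joined by an edge of $G$ having one endpoint in each) receive different colors. The strong chromatic index $\chi'_s(G)$ is the minimum $k$ for which $G$ has a strong $k$-edge-coloring. For a graph $G$ with at least one edge, $\sigma(G)=\max_{xy\in E(G)}\{\deg(x)+\deg(y)-1\}$. *)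

(* Defs.v *)
From HB Require Import structures.
From mathcomp Require Import all_boot all_order all_algebra.
From mathcomp Require Import all_classical all_reals all_analysis.

Set Implicit Arguments.
Unset Strict Implicit.
Unset Printing Implicit Defensive.

Import numFieldNormedType.Exports.

Record sgraph := SGraph {
  vertex :> finType;
  adj : rel vertex;
  adj_sym : symmetric adj;
  adj_irr : irreflexive adj }.

Notation "x -- y" := (adj x y) (at level 30).

Section Graph.
Variable G : sgraph.

Definition deg (x : G) : nat := #|[set y : G | x -- y]|.

Definition max_deg : nat := \max_(x : G) deg x.

(* Equal to 0 when there is no edge. *)
Definition sigma : nat :=
  \max_(p : G * G | p.1 -- p.2) (deg p.1 + deg p.2 - 1).

(* A cycle is the list of its vertices, without repetition of the first one, so
   its length is the size of the list; the bound on the size excludes lists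
   [:: x; y] with x -- y, which satisfy ucycle. *)
Definition graph_cycle (c : seq G) : Prop := ucycle (@adj G) c /\ 2 < size c.

(* Holds for every g when there is no cycle, i.e., when the girth is +oo. *)
Definition girth_at_least (g : nat) : Prop :=
  forall c : seq G, graph_cycle c -> g <= size c.

Definition edges : {set {set G}} :=
  [set A | [exists x : G, exists y : G, (x -- y) && (A == [set x; y])]].

Definition edge : finType := {A : {set G} | A \in edges}.

Definition within_distance2 (A B : edge) : bool :=
  [exists x in val A, x \in val B]
  || [exists x in val A, exists y in val B, x -- y].

Definition strong_edge_coloring k (c : {ffun edge -> 'I_k}) : bool :=
  [forall A : edge, forall B : edge,
    (A != B) && within_distance2 A B ==> (c A != c B)].

Definition strongly_colorable k : bool :=
  [exists c : {ffun edge -> 'I_k}, strong_edge_coloring c].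

Lemma strongly_colorable_ex : exists k, strongly_colorable k.
Proof.
exists #|edge|; apply/existsP; exists [ffun A => enum_rank A].
apply/forallP => A; apply/forallP => B; apply/implyP => /andP[neqAB _].
by rewrite !ffunE (inj_eq enum_rank_inj).
Qed.

Definition strong_chromatic_index : nat := ex_minn strongly_colorable_ex.

End Graph.

Section Planar.
Local Open Scope classical_set_scope.
Local Open Scope ring_scope.
Variables (R : realType) (G : sgraph).

(* Vertices are drawn as distinct points of the plane R * R, edges as simple
   arcs parametrized by [0, 1]; the parametrization may run in either
   direction. *)
Record plane_drawing (pos : G -> R * R) (arc : edge G -> R -> R * R) : Prop := {
  drawing_pos_inj : injective pos;
  drawing_arc_continuous :
    forall A : edge G, {within `[0, 1], continuous (arc A)};
  drawing_arc_inj :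
    forall A : edge G, {in `[0, 1] &, injective (arc A)};
  drawing_arc_ends :
    forall A : edge G, [set arc A 0; arc A 1] = pos @` [set` val A];
  drawing_arc_vertex :
    forall (A : edge G) (x : G) (t : R), t \in `]0, 1[ -> arc A t <> pos x;
  drawing_arc_disjoint :
    forall (A B : edge G) (s t : R), A != B ->
      s \in `]0, 1[ -> t \in `]0, 1[ -> arc A s <> arc B t }.

Definition planar : Prop := exists pos arc, plane_drawing pos arc.

End Planar.

Definition girth_bound (s : nat) : nat :=
  match s with
  | 5 => 41
  | 6 | 7 => 36
  | _ => 5 * s + 1
  end.

(* Main.v *)
(* A planar drawing is turned into a minor of a square grid: halves of arcs that
   start at different vertices are disjoint compact sets, hence a positive
   distance apart, so the pixels of a fine grid near the half arcs at a vertex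
   form its branch set. Deleting and contracting edges of the grid preserves its
   Euler inequality, which yields faces for every subgraph with no appeal to the
   Jordan curve theorem.

   A minimal counterexample has no removable leaf, so its non-leaf vertices induce
   a graph of minimum degree at least 2. Each face of that graph is at least as
   long as the girth, which exceeds 5L, and some face has at most five branch
   vertices; hence there is a path of L consecutive vertices of degree 2. In the
   original graph these vertices and their leaves form a caterpillar, which is
   uncoloured and coloured again from both ends with sigma colours. That this is
   possible is shown by induction on sigma: one colour is placed on the
   caterpillar so that all degree conditions drop by one. The cases sigma = 5, 6, 7
   are decided by a computation. *)

From mathcomp Require Import all_boot zify.
Require Import Defs.

Set Implicit Arguments.
Unset Strict Implicit.
Unset Printing Implicit Defensive.

(** A strong colouring of a caterpillar is governed by the colour sets of its spine vertices, since
    the leaves at a vertex may take its other colours in any order. Away from the ends, the vertices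
    that receive the removed colour can be marked greedily. The obstacle is that both end sets are
    prescribed, so the colour has to suit both at once; the freedom for this lies in the choice of
    the first spine edge. Each further colour thus costs one spine vertex, which is why the girth
    bound grows with slope five in sigma, five being the number of branch vertices on some face.
    Seven colours are computed as well, because a step from six would make the thread one vertex
    longer than the bound allows.

    The Euler inequality says nothing about the shape of a face boundary. It is therefore carried
    along with a parity condition, which provides a cycle in each boundary, and with the
    connectedness of the dual, which makes the boundaries nonempty. *)

(** * Colour sets along the spine of a caterpillar *)

Lemma subset_between (T : finType) (A B : {set T}) m :
  A \subset B -> #|A| <= m <= #|B| ->
  exists D : {set T}, [/\ A \subset D, D \subset B & #|D| = m].
Proof.
move=> sAB /andP[leAm lemB].
pose s := take (m - #|A|) (enum (B :\: A)).
have us : uniq s by rewrite take_uniq ?enum_uniq.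
have ins x : x \in s -> (x \in B) && (x \notin A).
  by move/mem_take; rewrite mem_enum inE andbC.
exists (A :|: [set x in s]); split; first exact: subsetUl.
  rewrite subUset sAB; apply/subsetP => x; rewrite inE => /ins /andP[] //.
rewrite cardsU (_ : A :&: _ = set0) ?cards0 ?subn0; last first.
  by apply/setP => x; rewrite !inE; apply/negbTE/negP => /andP[xA /ins /andP[_]]; rewrite xA.
rewrite (_ : #|[set x in s]| = size s); last by rewrite cardsE (card_uniqP us).
rewrite size_take -cardE cardsD (setIidPr sAB).
by case: ifP => ?; lia.
Qed.

(** With [k] for sigma, these are the hypotheses on the maximum degree and on the degree sum of an
    edge; a spine vertex is not a leaf. *)
Definition spine_degree k d := (1 < d) && (d.+2 <= k).
Definition spine_edge k (d d' : nat) := d + d' <= k.+1.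

Section Spine.
Variable T : finType.
Implicit Types (U C D : {set T}) (c : T).

(* C is the set of colours at a vertex of the spine of a caterpillar and c the
   colour of the spine edge entering it; ds lists the degrees of the following
   spine vertices, the last of which has colour set C' and is left by an edge of
   colour c'. The colouring is strong iff the colour sets of adjacent vertices
   share only the colour of their edge. *)
Fixpoint spine_ext U C c (ds : seq nat) C' c' : Prop :=
  if ds is d :: ds' then
    exists o D, [/\ o \in C :\ c, #|D| = d, D \subset U, C :&: D = [set o]
                  & spine_ext U D o ds' C' c']
  else C = C' /\ c != c'.

(** [C] belongs to the first of [n.+1] spine vertices. [c] may lie outside [C] and [c'] outside
    [C']: this happens when the colour removed in the induction is that of the entering or the
    leaving edge. *)
Definition spine_extendable k n := forall U C C' c c' d ds,
  #|U| = k -> C \subset U -> C' \subset U -> size ds = n ->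
  all (spine_degree k) (d :: ds) -> path (spine_edge k) d ds ->
  #|C| = d -> #|C'| = last d ds -> spine_ext U C c ds C' c'.

(* The boolean s tells whether the colour a to be removed is used at the first
   vertex. It must be used at vertices of degree k - 1, on one end of each edge of
   degree sum k + 2, and never on both ends. *)
Lemma spine_reduce k d ds (b : bool) : 5 < k ->
  all (spine_degree k.+1) (d :: ds) -> path (spine_edge k.+1) d ds ->
  (last d ds <= 3 -> ~~ b) -> ((last d ds).+1 = k -> b) ->
  exists (s : bool) es,
  [/\ size es = size ds, all (spine_degree k) (d - s :: es) /\
       path (spine_edge k) (d - s) es, last (d - s) es = last d ds - b,
       (d <= 3 -> ~~ s) /\ (d.+1 = k -> s)
    & forall U D o C' c' a, a \in U -> (a \in D) = s -> (a \in C') = b ->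
      D \subset U -> spine_ext (U :\ a) (D :\ a) o es (C' :\ a) c' ->
      spine_ext U D o ds C' c'].
Proof.
move=> k5; rewrite /spine_degree /spine_edge.
elim: ds d => [|d2 ds IH] d /=.
  rewrite andbT => dk _ b3 bk; exists b, [::]; split=> //.
    by split=> //=; case: b b3 bk => b3 bk /=; lia.
  move=> U D o C' c' a _ aD aC' _ [eqDC neq]; split=> //; apply/setP => x.
  by case: (x =P a) => [-> | /eqP xa]; [rewrite aD aC' | move/setP/(_ x): eqDC; rewrite !inE xa].
move=> /andP[dk alls] /andP[edge pth] b3 bk.
have [s2 [es [sz [alles pthes] lastes [s3 sk] lift]]] := IH d2 alls pth b3 bk.
(* Greedy marking from the right: a vertex is marked when its degree forces it, or when its edge to
   the next vertex is tight and that vertex is unmarked. If [d <= 3], tightness gives [d2 = k - 1],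
   and the next vertex is marked already. *)
pose s := (d.+1 == k) || [&& 3 < d, d + d2 == k.+2 & ~~ s2].
(* If [d = k - 1], the edge condition gives [d2 <= 3], so [s2] is false. *)
have excl : ~~ (s && s2).
  rewrite /s; case: eqP => [dk'|_] /=.
    by apply: s3; lia.
  by case: (s2); rewrite /= ?andbF.
have tight : d + d2 == k.+2 -> s || s2.
  rewrite /s => dd; rewrite dd /=; case: (boolP (3 < d)) => d3 /=.
    by case: (s2); rewrite ?orbT.
  by rewrite sk ?orbT //; lia.
exists s, (d2 - s2 :: es); split=> //=.
- by rewrite sz.
- have sd : s -> 2 < d by rewrite /s => /orP[/eqP|/and3P[]]; lia.
  have ds' : d.+1 = k -> s by rewrite /s => ->; rewrite eqxx.
  split; last by rewrite pthes andbT; move: excl tight; case: (s); case: (s2) => //=; lia.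
  move: alles => /= /andP[-> ->]; rewrite andbT.
  by move: sd ds'; case: (s) => /=; lia.
- by rewrite /s; split; [lia | move=> ->; rewrite eqxx].
move=> U D o C' c' a aU aD aC' sDU [o' [D' [o'in cD' sD' intD ext]]].
have aD' : a \notin D' by apply/negP => /(subsetP sD'); rewrite !inE eqxx.
(* The spine colour [o'] comes from the reduced set, hence differs from [a]; as [a] is never in both
   [D] and [D2], putting it back leaves their intersection unchanged. *)
pose D2 := if s2 then a |: D' else D'.
have aD2 : (a \in D2) = s2 by rewrite /D2; case: (s2); rewrite ?setU11 ?(negbTE aD').
have D2a : D2 :\ a = D'.
  apply/setP => x; rewrite /D2; case: (s2); rewrite !inE.
    by case: eqP => //= ->; rewrite (negbTE aD').
  by case: eqP => //= ->; rewrite (negbTE aD').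
have sD2 : D2 \subset U.
  have sD'U : D' \subset U by apply: subset_trans sD' (subsetDl _ _).
  by rewrite /D2; case: ifP => // _; rewrite subUset sub1set aU.
exists o', D2; split => //.
- by move: o'in; rewrite !inE => /and3P[-> _ ->].
- rewrite (cardsD1 a) aD2 D2a cD'; move: alls => /andP[/andP[d2gt _] _].
  by rewrite subnKC // (leq_trans (leq_b1 _) (ltnW d2gt)).
- apply/setP => x; move/setP/(_ x): intD; rewrite -D2a !inE.
  by case: (x =P a) => [-> | _] //=; rewrite aD aD2 (negbTE excl) => <-.
- by apply: lift aU aD2 aC' sD2 _; rewrite D2a.
Qed.

(** [D] consists of [o] and [d2 - 1] colours outside [C]. A colour [a] in [C] can enter only as [o];
    one outside [C] can always be included, but leaving it out costs an available colour, hence the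
    sharper bound. *)
Lemma spine_next U C o a s d2 :
  o \in C -> C \subset U -> a \in U -> 1 < d2 -> #|C| + d2 <= #|U|.+1 ->
  (if a \in C then (a == o) == s else s || (#|C| + d2 <= #|U|)) ->
  exists D, [/\ #|D| = d2, D \subset U, C :&: D = [set o] & (a \in D) = s].
Proof.
move=> oC sCU aU d2gt le hs.
have cUC : #|U :\: C| = #|U| - #|C| by rewrite cardsD (setIidPr sCU).
have [A [B [sAB cAB sBU hP]]] : exists A B : {set T},
  [/\ A \subset B, #|A| <= d2.-1 <= #|B|, B \subset U :\: C &
    forall P : {set T}, A \subset P -> P \subset B -> (a \in o |: P) = s].
  case: (boolP (a \in C)) hs => aC hs.
    exists set0, (U :\: C); split; rewrite ?sub0set ?cards0 ?cUC //=; first by lia.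
    move=> P _ sP; rewrite !inE (eqP hs) orbC; case: (boolP (a \in P)) => //=.
    by move/(subsetP sP); rewrite inE aC.
  have ao : (a == o) = false by apply: contraNF aC => /eqP->.
  case: s hs => /= hs.
    exists [set a], (U :\: C); split; rewrite ?sub1set ?inE ?aC ?aU ?cards1 ?cUC //=; first by lia.
    by move=> P; rewrite sub1set => aP _; rewrite !inE aP orbT.
  exists set0, ((U :\: C) :\ a); split; rewrite ?sub0set ?cards0 ?subsetDl //.
    by have := cardsD1 a (U :\: C); rewrite !inE aC aU cUC /=; lia.
  by move=> P _ sP; rewrite !inE ao; apply: contraTF sP => aP; apply/subsetPn; exists a; rewrite ?inE ?eqxx.
have [P [sAP sPB cP]] := subset_between sAB cAB.
have sPU := subset_trans sPB sBU.
have oP : o \notin P by apply/negP => /(subsetP sPU); rewrite inE oC.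
exists (o |: P); split.
- by rewrite cardsU1 oP cP add1n prednK // ltnW.
- by rewrite subUset sub1set (subsetP sCU _ oC); apply: subset_trans sPU (subsetDl _ _).
- apply/setP => x; rewrite !inE; case: eqP => [->|_] /=; first by rewrite oC.
  by apply/negbTE/negP => /andP[xC /(subsetP sPU)]; rewrite inE xC.
- exact: hP.
Qed.

(** The first spine edge is coloured by hand, the other [n] by induction without the colour [a]. The
    boolean [b] decides whether [a] is in [C']; the mark [s] of the second vertex, which results
    from [b], must then be compatible with [C]. *)
Lemma spine_step k n : 5 < k -> spine_extendable k n -> spine_extendable k.+1 n.+1.
Proof.
move=> k5 IH U C C' c c' d [|d2 ds] cU sCU sC'U //= [sz] /andP[dk alls] /andP[edge pth] cC cC'.
have [dgt dle] := andP dk.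
have [d2gt d2le] : 1 < d2 /\ d2.+2 <= k.+1 by case/andP: alls => /andP[].
have lastk : 1 < #|C'| /\ #|C'|.+2 <= k.+1.
  by rewrite cC'; apply/andP; exact: (@allP _ _ (d2 :: ds) alls _ (mem_last _ _)).
subst d.
(* It suffices to find, for one admissible [b] and every admissible mark [s], a colour [a] and a
   colour [o] of the first spine edge. *)
have key (b : bool) : (#|C'| <= 3 -> ~~ b) -> (#|C'|.+1 = k -> b) ->
    (forall s : bool, (d2 <= 3 -> ~~ s) -> (d2.+1 = k -> s) ->
     exists a o, [/\ a \in U, (a \in C') = b, o \in C :\ c &
       if a \in C then (a == o) == s else s || (#|C| + d2 <= #|U|)]) ->
    spine_ext U C c (d2 :: ds) C' c'.
  move=> b3 bk hs; rewrite cC' in b3 bk.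
  have [s [es [szes [alles pthes] lastes [s3 sk] lift]]] := spine_reduce k5 alls pth b3 bk.
  have [a [o [aU aC' oC cond]]] := hs s s3 sk.
  have [oc oC'] := setD1P oC.
  have edge' : #|C| + d2 <= #|U|.+1 by rewrite cU.
  have [D [cD sDU CD aD]] := spine_next oC' sCU aU d2gt edge' cond.
  exists o, D; split => //; apply: (lift _ _ _ _ _ a) => //.
  have cDD := cardsD1 a D; have cCC := cardsD1 a C'; have cUU := cardsD1 a U.
  rewrite aD cD in cDD; rewrite aC' cC' in cCC; rewrite aU cU in cUU.
  have cDs : #|D :\ a| = d2 - s by rewrite cDD addKn.
  apply: IH => //; rewrite ?cDs //; first by move: cUU; rewrite add1n => -[<-].
  - exact: setSD.
  - exact: setSD.
  - by rewrite szes.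
  - by rewrite lastes cCC addKn.
clear IH alls pth dk sz.
have cCc : #|C|.-1 <= #|C :\ c| by rewrite (cardsD1 c C); case: (c \in C); rewrite ?add0n ?leq_pred.
have [o oC] : exists o, o \in C :\ c by apply/set0Pn; rewrite -card_gt0; lia.
have fresh : #|C :|: C'| < k.+1 -> exists2 a, a \in U & (a \notin C) && (a \notin C').
  rewrite -cU => lt; have [|a] := subsetPn (_ : ~~ (U \subset C :|: C')).
    by apply: contraTN lt => /subset_leq_card; rewrite -leqNgt.
  by rewrite inE negb_or; exists a.
have diff : #|C| < #|C'| -> exists2 a, a \in C' & a \notin C.
  move=> lt; have [|a aC' aC] := subsetPn (_ : ~~ (C' \subset C)); last by exists a.
  by apply: contraTN lt => /subset_leq_card; rewrite -leqNgt.
(* A colour of [C] other than [c] serves either mark: it is used as [o] to put it at the second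
   vertex, and another [o] is taken to keep it away. *)
have usual a : a \in C :\ c -> 2 < #|C| -> forall s : bool, exists a0 o,
    [/\ a0 \in U, (a0 \in C') = (a \in C'), o \in C :\ c &
       if a0 \in C then (a0 == o) == s else s || (#|C| + d2 <= #|U|)].
  move=> aC dgt3 [].
    by exists a, a; case/setD1P: (aC) => ac aC1; rewrite aC1 eqxx (subsetP sCU).
  have [o' o'in] : exists o', o' \in C :\ c :\ a.
    apply/set0Pn; rewrite -card_gt0.
    by move: cCc; rewrite (cardsD1 a (C :\ c)) aC; lia.
  case/setD1P: o'in => o'a o'C; exists a, o'; case/setD1P: (aC) => ac aC1.
  by rewrite aC1 [a == _]eq_sym (negbTE o'a) (subsetP sCU).
case: (leqP #|C| 2) => [d2'|d3].
  have nt : #|C| + d2 <= #|U| by rewrite cU; lia.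
  have [Lk|Lk] := eqVneq #|C'|.+1 k.
    have [|a aC' aC] := diff; first by lia.
    apply: (key true); [by lia | by [] | move=> s _ _; exists a, o].
    by rewrite aC' (subsetP sC'U _ aC') (negbTE aC) nt orbT.
  have [|a aU /andP[aC aC']] := fresh.
    by rewrite cardsU; lia.
  apply: (key false); [by [] | by move/eqP; rewrite (negbTE Lk) | move=> s _ _; exists a, o].
  by rewrite aU (negbTE aC) (negbTE aC') nt orbT.
(* A tight first edge with [#|C| = 3] has [d2 = k - 1], where the mark is forced. *)
have tight3 (s : bool) : (d2.+1 = k -> s) -> #|C| = 3 -> s || (#|C| + d2 <= #|U|).
  by rewrite cU => sk ->; have [/sk->|] := eqVneq d2.+1 k; rewrite // => ?; apply/orP; right; lia.
have [Lk|Lk] := eqVneq #|C'|.+1 k.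
  apply: (key true); [by lia | by [] | move=> s _ sk].
  have [/exists_inP[a aC aC']|no] := boolP [exists a in C :\ c, a \in C'].
    by have := usual a aC d3 s; rewrite aC'.
  (* Only two colours lie outside [C'], so [#|C| = 3], and [tight3] allows any colour of [C']
     outside [C]. *)
  have sub : C :\ c \subset U :\: C'.
    apply/subsetP => x xC; rewrite inE (subsetP sCU) ?andbT; last by case/setD1P: xC.
    by apply: contra no => xC'; apply/exists_inP; exists x.
  have le2 := subset_leq_card sub; rewrite [#|U :\: C'|]cardsD (setIidPr sC'U) cU in le2.
  have [|a aC' aC] := diff; first by lia.
  exists a, o; rewrite aC' (subsetP sC'U _ aC') (negbTE aC); split => //.
  by apply: tight3 => //; move: cCc le2 Lk d3; clear; lia.
have [/exists_inP[a aC aC']|no] := boolP [exists a in C :\ c, a \notin C'].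
  apply: (key false); [by [] | by move/eqP; rewrite (negbTE Lk) | move=> s _ _].
  by have := usual a aC d3 s; rewrite (negbTE aC').
have sub : C :\ c \subset C'.
  by apply/subsetP => x xC; apply: contraR no => xC'; apply/exists_inP; exists x.
case: (leqP #|C'| 3) => L3; last first.
  apply: (key true); [by lia | by [] | move=> s _ _].
  by have := usual o oC d3 s; rewrite (subsetP sub _ oC).
have le3 := subset_leq_card sub.
have sCC' : C :|: C' \subset c |: C'.
  rewrite subUset subsetUr andbT; apply/subsetP => x xC; rewrite !inE.
  by case: eqP => //= /eqP xc; apply: (subsetP sub); rewrite !inE xc.
have [|a aU /andP[aC aC']] := fresh.
  by have := subset_leq_card sCC'; rewrite cardsU1; move: (leq_b1 (c \notin C')) L3 k5; clear; lia.
apply: (key false); [by [] | by move/eqP; rewrite (negbTE Lk) | move=> s _ sk].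
have [nt|tight] := boolP (s || (#|C| + d2 <= #|U|)).
  by exists a, o; rewrite aU (negbTE aC) (negbTE aC').
have cC4 : #|C| = 4.
  apply/eqP; rewrite eqn_leq; apply/andP; split.
    by move: (leq_trans cCc (leq_trans le3 L3)); clear; lia.
  by rewrite ltn_neqAle d3 andbT; apply: contra tight => /eqP/esym; apply: tight3.
have cinC : c \in C.
  apply: contraT => cC; have := cardsD1 c C; rewrite (negbTE cC) cC4 add0n => eq4.
  by have := leq_trans le3 L3; rewrite -eq4.
have eqC : C :\ c = C'.
  by apply/eqP; rewrite eqEcard sub; have := cardsD1 c C; rewrite cC4 cinC add1n => -[<-].
(* What remains: [C] is [C'] together with [c], the first edge is tight and the second vertex
   unmarked. Then [c] itself can be removed, being in [C], not in [C'] and different from [o]. *)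
exists c, o; split => //; first exact: (subsetP sCU).
  by rewrite -eqC !inE eqxx.
rewrite cinC [c == _]eq_sym; case/setD1P: oC => /negbTE-> _.
by case: (s) tight.
Qed.

End Spine.

(** * Deciding the small cases by tables of profiles *)

(* For a fixed right end (C', c'), whether a colour set C can be extended depends
   only on its profile, the numbers of its colours in the classes [set c'],
   C' :\ c' and ~: C' (of sizes n). A table lists, for each profile, the classes
   whose colours can be given to the next spine edge. *)
Definition profiles (n : seq nat) d : seq (seq nat) :=
  [seq [:: ab.1; ab.2; d - (ab.1 + ab.2)]
    | ab <- allpairs pair (iota 0 (nth 0 n 0).+1) (iota 0 (nth 0 n 1).+1)
    & (ab.1 + ab.2 <= d <= ab.1 + ab.2 + nth 0 n 2)].

Definition usable (x : seq nat) (ok : bitseq) : nat :=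
  nth false ok 0 * nth 0 x 0 + nth false ok 1 * nth 0 x 1 + nth false ok 2 * nth 0 x 2.

Definition meets_at (n x y : seq nat) t :=
  [&& 0 < nth 0 x t, 0 < nth 0 y t
    & all (fun s => nth 0 x s + nth 0 y s <= (s == t) + nth 0 n s) (iota 0 3)].

(** The next set needs a usable colour other than the entering one. If class [t] is usable, the
    entering colour is itself counted, hence the comparison with a boolean. *)
Definition table_row (n : seq nat) (tab : seq (seq nat * bitseq)) x : bitseq :=
  [seq has (fun yk => meets_at n x yk.1 t && (nth false yk.2 t < usable yk.1 yk.2)) tab
    | t <- iota 0 3].

Definition table_step n tab d := [seq (x, table_row n tab x) | x <- profiles n d].

(** Degrees are explored from the right. At the left end two usable colours are asked for, because
    one may be the colour of the entering edge. *)
Fixpoint table_check k n len d tab : bool :=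
  all (fun d0 => (d0 + d <= k.+1) ==>
    (let tab' := table_step n tab d0 in
     if len is len'.+1 then table_check k n len' d0 tab'
     else all (fun yk => 1 < usable yk.1 yk.2) tab'))
  (iota 2 (k - 3)).

(** The initial table describes the last vertex: its set must be [C'], and only the class of [c'] is
    usable for the leaving edge. *)
Definition spine_check k len :=
  all (fun d => table_check k [:: 1; d.-1; k - d] len d [:: ([:: 1; d.-1; 0], [:: true])])
    (iota 2 (k - 3)).

Section SpineTable.
Variables (T : finType) (U C' : {set T}) (c' : T) (k e : nat).
Hypotheses (cU : #|U| = k) (sC'U : C' \subset U) (cC' : #|C'| = e) (c'C' : c' \in C').

Let ord3 i (lti : i < 3) : 'I_3 := Ordinal lti.

Definition colour_class (x : T) : 'I_3 :=
  if x == c' then @ord3 0 isT else if x \in C' then @ord3 1 isT else @ord3 2 isT.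

Let cnt (C : {set T}) (i : 'I_3) := #|[set x in C | colour_class x == i]|.
Let n := [:: 1; e.-1; k - e].

Lemma card_colour_class i : cnt U i = nth 0 n i.
Proof.
rewrite /cnt; case: i => -[|[|[|//]]] lti /=.
- rewrite (_ : [set _ in _ | _] = [set c']) ?cards1 //; apply/setP => x; rewrite !inE /colour_class.
  by case: (x =P c') => [->|_]; [rewrite (subsetP sC'U) | case: ifP; rewrite andbF].
- rewrite (_ : [set _ in _ | _] = C' :\ c'); last first.
    apply/setP => x; rewrite !inE /colour_class; case: (x =P c') => [->|_]; rewrite ?andbF //=.
    by case: ifP => xC'; rewrite ?andbF // andbT (subsetP sC'U).
  by rewrite -cC' (cardsD1 c' C') c'C'.
- rewrite (_ : [set _ in _ | _] = U :\: C'); last first.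
    apply/setP => x; rewrite !inE /colour_class; case: (x =P c') => [->|_]; rewrite ?andbF ?c'C' //=.
    by case: ifP => xC'; rewrite ?andbF // andbT.
  by rewrite cardsD (setIidPr sC'U) cU cC'.
Qed.

Lemma cnt_le (C : {set T}) i : C \subset U -> cnt C i <= nth 0 n i.
Proof.
move=> sCU; rewrite -card_colour_class; apply/subset_leq_card/subsetP => x.
by rewrite !inE => /andP[/(subsetP sCU)-> ->].
Qed.

Lemma usableE (C : {set T}) x ok : (forall i, cnt C i = nth 0 x i) ->
  #|[set o in C | nth false ok (colour_class o)]| = usable x ok.
Proof.
move=> cntC; rewrite -sum1dep_card (partition_big colour_class predT) //=.
rewrite /usable !big_ord_recl big_ord0 addn0 addnA.
have eq i : \sum_(o | ((o \in C) && nth false ok (colour_class o)) && (colour_class o == i)) 1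
    = nth false ok i * nth 0 x i.
  rewrite -cntC /cnt; case: (boolP (nth false ok i)) => oki.
    rewrite mul1n -sum1dep_card; apply: eq_bigl => o.
    by rewrite -andbA [_ && (_ == _)]andbC; case: eqP => [->|]; rewrite ?andbF ?oki.
  rewrite big1 // => o; case: eqP => [->|]; last by rewrite andbF.
  by rewrite (negbTE oki) andbF.
by rewrite !eq.
Qed.

Lemma cnt_sum (C : {set T}) x : (forall i, cnt C i = nth 0 x i) ->
  #|C| = nth 0 x 0 + nth 0 x 1 + nth 0 x 2.
Proof.
move/(@usableE C x (nseq 3 true)); rewrite /usable /= !mul1n => <-.
congr #|pred_of_set _|; apply/setP => o; rewrite !inE.
by case: (colour_class o) => -[|[|[|//]]] lti /=; rewrite andbT.
Qed.

Lemma meets_atP (C : {set T}) x y o : C \subset U -> o \in C ->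
  (forall i, cnt C i = nth 0 x i) -> meets_at n x y (colour_class o) ->
  exists D : {set T}, [/\ D \subset U, C :&: D = [set o] & forall i, cnt D i = nth 0 y i].
Proof.
move=> sCU oC cntC /and3P[_ y0 /allP le]; set t := colour_class o in y0 le.
(* [E i] collects the colours of class [i] taken outside [C]; the class of [o] needs one fewer, as
   [o] supplies one. *)
have [i|E hE] := @fin_all_exists _ _ (fun (i : 'I_3) (E : {set T}) =>
    E \subset [set p in U :\: C | colour_class p == i] /\ #|E| = nth 0 y i - (i == t)).
  have := @subset_between _ set0 [set p in U :\: C | colour_class p == i] (nth 0 y i - (i == t)) (sub0set _).
  have -> : #|[set p in U :\: C | colour_class p == i]| = nth 0 n i - nth 0 x i.
    rewrite -card_colour_class -cntC /cnt.
    rewrite (_ : [set _ in _ :\: _ | _] =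
      [set p in U | colour_class p == i] :\: [set p in C | colour_class p == i]); last first.
      by apply/setP => p; rewrite !inE; case: eqP; rewrite ?andbF ?andbT.
    rewrite cardsD (setIidPr _) //; apply/subsetP => p; rewrite !inE.
    by case/andP => /(subsetP sCU)->.
  rewrite cards0 /= => -[|E [_ sE cE]]; last by exists E.
  have := le i; rewrite mem_iota ltn_ord => /(_ isT).
  by rewrite -[(i : nat) == t]/(i == t) leq_subLR addnBA ?leq_subRL -?addnA; move: (cnt_le i sCU); rewrite cntC; lia.
have sEU i : E i \subset U.
  by apply: subset_trans (hE i).1 _; apply/subsetP => p; rewrite !inE => /andP[/andP[]].
have oE i : o \notin E i.
  by apply/negP => /(subsetP (hE i).1); rewrite !inE oC.
exists (o |: \bigcup_i E i); split.
- by rewrite subUset sub1set (subsetP sCU) //; apply/bigcupsP => i _.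
- apply/setP => p; rewrite !inE; case: eqP => [->|_]; first by rewrite oC.
  apply/negP => /andP[pC /bigcupP[i _ /(subsetP (hE i).1)]].
  by rewrite !inE pC.
move=> i; have eqs : [set p in o |: \bigcup_j E j | colour_class p == i] =
    if i == t then o |: E i else E i.
  have inB p : (p \in \bigcup_j E j) && (colour_class p == i) = (p \in E i).
    have pE j : p \in E j -> colour_class p = j.
      by move/(subsetP (hE j).1); rewrite inE => /andP[_ /eqP].
    apply/idP/idP => [/andP[/bigcupP[j _ pj] /eqP <-]|pi]; first by rewrite (pE j).
    by rewrite (pE i) // eqxx andbT; apply/bigcupP; exists i.
  apply/setP => p; rewrite inE in_setU in_set1 andb_orl inB.
  case: (p =P o) => [->|/eqP po] /=; last by case: ifP; rewrite // in_setU1 (negbTE po).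
  by rewrite (negbTE (oE i)) orbF -/t eq_sym; case: ifP; rewrite ?setU11 ?(negbTE (oE i)).
rewrite /cnt eqs; have := (hE i).2; case: (i =P t) => [->|_] cE; last by rewrite cE subn0.
by rewrite cardsU1 oE cE add1n subn1 prednK.
Qed.

Definition table_sound (tab : seq (seq nat * bitseq)) d ds := forall x ok, (x, ok) \in tab ->
  nth 0 x 0 + nth 0 x 1 + nth 0 x 2 = d /\
  forall C : {set T}, C \subset U -> (forall i, cnt C i = nth 0 x i) ->
  forall o c, o \in C -> nth false ok (colour_class o) -> o != c -> spine_ext U C c ds C' c'.

Lemma table_init : table_sound [:: ([:: 1; e.-1; 0], [:: true])] e [::].
Proof.
move=> x ok; rewrite inE => /eqP[-> ->]; split=> /=.
  by rewrite addn0 add1n prednK // -cC' card_gt0; apply/set0Pn; exists c'.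
move=> C sCU cntC o c oC; have -> : nth false [:: true] (colour_class o) = (o == c').
  by rewrite /colour_class; case: ifP => // _; case: ifP.
move=> /eqP-> c'c; split; last by rewrite eq_sym.
have eC' i : cnt C' i = nth 0 [:: 1; e.-1; 0] i.
  have := card_colour_class i; rewrite /cnt; case: i => -[|[|[|//]]] lti /= cUi.
  - by rewrite (_ : [set _ in _ | _] = [set c']) ?cards1 //; apply/setP => p;
      rewrite !inE /colour_class; case: (p =P c') => [->|_]; [rewrite c'C' | case: ifP; rewrite andbF].
  - rewrite -cUi; congr #|pred_of_set _|; apply/setP => p; rewrite !inE /colour_class.
    by case: (p =P c') => _; rewrite ?andbF //; case: ifP => pC'; rewrite ?andbF // (subsetP sC'U).
  - apply/eqP; rewrite cards_eq0; apply/eqP/setP => p; rewrite !inE /colour_class.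
    by case: (p =P c') => _; rewrite ?andbF //; case: ifP => pC'; rewrite ?andbF.
apply/eqP; rewrite eqEcard (cnt_sum cntC) (cnt_sum eC') leqnn andbT.
apply/subsetP => p pC; have := cntC (@ord3 2 isT); rewrite /cnt => /eqP.
rewrite cards_eq0 => /eqP/setP/(_ p); rewrite !inE pC /colour_class /=.
by case: (p =P c') => [-> //|_]; case: ifP.
Qed.

Lemma profile_of (C : {set T}) : C \subset U ->
  exists2 x, x \in profiles n #|C| & forall i, cnt C i = nth 0 x i.
Proof.
move=> sCU; pose f := [:: cnt C (@ord3 0 isT); cnt C (@ord3 1 isT); cnt C (@ord3 2 isT)].
have cntf i : cnt C i = nth 0 f i.
  by case: i => -[|[|[|//]]] lti; congr (cnt C _); apply: val_inj.
exists f => //; rewrite (cnt_sum cntf) /f; apply/mapP.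
exists (cnt C (@ord3 0 isT), cnt C (@ord3 1 isT)); last by rewrite /= addKn.
rewrite mem_filter; apply/andP; split.
  by rewrite /= leq_addr leq_add2l (cnt_le (@ord3 2 isT)).
by apply: allpairs_f; rewrite mem_iota add0n ltnS;
  [apply: (cnt_le (@ord3 0 isT)) | apply: (cnt_le (@ord3 1 isT))].
Qed.

Lemma table_stepP tab d d0 ds :
  table_sound tab d ds -> table_sound (table_step n tab d0) d0 (d :: ds).
Proof.
move=> sound x _ /mapP[_ /mapP[[a b]] + -> [-> ->]]; rewrite mem_filter => /andP[le _].
split=> [|C sCU cntC o c oC]; first by move: le => /=; clear; lia.
rewrite /table_row (nth_map 0) ?size_iota ?ltn_ord // nth_iota ?ltn_ord // add0n.
move=> /hasP[[y ok] yin /= /andP[meet us]] oc.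
have [sumy good] := sound y ok yin.
have [D [sDU CD cntD]] := meets_atP sCU oC cntC meet.
exists o, D; split => //; rewrite ?(cnt_sum cntD) // ?inE ?oc //.
have oD : o \in D by have := set11 o; rewrite -CD inE => /andP[].
have [o' /andP[o'o okD]] : exists o', (o' != o) && (o' \in [set p in D | nth false ok (colour_class p)]).
  have : 0 < #|[set p in D | nth false ok (colour_class p)] :\ o|.
    by move: us; rewrite -(usableE ok cntD) (cardsD1 o) inE oD /=; case: (nth _ _ _).
  by rewrite card_gt0 => /set0Pn[o']; rewrite inE in_set1 => ?; exists o'.
by move: okD; rewrite inE => /andP[o'D ok']; apply: good ok' o'o.
Qed.

(** [pre] is the unexplored part of the spine. Its head is the degree of the vertex with set [C],
    which is not among the following degrees; hence [behead]. *)
Lemma table_checkP len tab d ds pre (C : {set T}) c :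
  table_check k n len d tab -> table_sound tab d ds -> size pre = len.+1 ->
  all (spine_degree k) pre -> sorted (spine_edge k) (rcons pre d) ->
  C \subset U -> #|C| = head 0 pre -> spine_ext U C c (behead (pre ++ d :: ds)) C' c'.
Proof.
have degree d0 : spine_degree k d0 -> d0 \in iota 2 (k - 3).
  by rewrite mem_iota /spine_degree; lia.
elim: len tab d ds pre => [|len IH] tab d ds pre /allP check sound.
  case: pre => [|d0 [|//]] //= _; rewrite andbT => degd0; rewrite andbT => edge sCU cC.
  have /implyP/(_ edge)/allP all2 := check d0 (degree d0 degd0).
  have [x xin cntC] := profile_of sCU; rewrite cC in xin.
  pose ok := table_row n tab x.
  have xok : (x, ok) \in table_step n tab d0 by apply/mapP; exists x.
  have := all2 _ xok; rewrite /= -(usableE _ cntC) => us.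
  have [_ good] := table_stepP sound xok.
  have [o /andP[oc]] : exists o, (o != c) && (o \in [set p in C | nth false ok (colour_class p)]).
    have : 0 < #|[set p in C | nth false ok (colour_class p)] :\ c|.
      by move: us; rewrite (cardsD1 c); case: (c \in _) => //; apply: ltnW.
    by rewrite card_gt0 => /set0Pn[o]; rewrite inE in_set1 => ?; exists o.
  by rewrite inE => /andP[oC oko]; apply: good oko oc.
case/lastP: pre => // pre d0; rewrite size_rcons => -[szpre].
rewrite all_rcons => /andP[degd0 degpre] edges sCU cC.
have [edge edges'] : spine_edge k d0 d /\ sorted (spine_edge k) (rcons pre d0).
  case: pre edges {szpre degpre cC} => [|p pre] /=; first by rewrite andbT.
  by rewrite [path _ _ (rcons _ d)]rcons_path last_rcons => /andP[].
have /implyP/(_ edge) check0 := check d0 (degree d0 degd0).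
have := IH _ _ _ pre check0 (table_stepP sound) szpre degpre edges' sCU.
rewrite cat_rcons; apply; rewrite cC.
by case: pre szpre {degpre edges edges' cC}.
Qed.

End SpineTable.

(** The colour entering the last vertex is in [C'], so it differs from any [c'] outside [C']. This
    reduces the tables to [c'] in [C']. *)
Lemma spine_ext_notin (T : finType) (U C C' : {set T}) c d ds (c0 c' : T) :
  c' \notin C' -> spine_ext U C c (rcons ds d) C' c0 -> spine_ext U C c (rcons ds d) C' c'.
Proof.
move=> c'C'; elim: ds C c => [|d2 ds IH] C c [o [D [oC cD sDU CD ext]]].
  exists o, D; split=> //=; case: ext => DC' _; split=> //.
  apply: contraNneq c'C' => <-; rewrite -DC'.
  by have := set11 o; rewrite -CD inE => /andP[].
by exists o, D; split=> //; apply: IH.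
Qed.

Lemma spine_checkP (T : finType) k len : spine_check k len -> spine_extendable T k len.+1.
Proof.
move=> /allP check U C C' c c' d ds cU sCU sC'U szds.
case/lastP: ds szds => // ds e; rewrite size_rcons => -[szds] degs edges cC cC'.
rewrite last_rcons in cC'.
have dege : spine_degree k e by move: degs; rewrite -rcons_cons all_rcons => /andP[].
wlog c'C' : c' / c' \in C'.
  move=> main; have [/main //|c'C'] := boolP (c' \in C').
  have [c0 c0C'] : exists c0, c0 \in C'.
    by apply/set0Pn; rewrite -card_gt0 cC'; case/andP: dege => /ltnW.
  exact: spine_ext_notin c'C' (main c0 c0C').
have checke := check e (_ : e \in iota 2 (k - 3)).
have {}checke : table_check k [:: 1; e.-1; k - e] len e [:: ([:: 1; e.-1; 0], [:: true])].
  by apply: checke; rewrite mem_iota; move: dege; rewrite /spine_degree; lia.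
have sound := @table_init T U C' c' k e cU sC'U cC' c'C'.
have := @table_checkP T U C' c' k e cU sC'U cC' c'C' len _ e [::] (d :: ds) C c checke sound.
rewrite /= szds cats1; apply=> //.
by move: degs; rewrite -rcons_cons all_rcons => /andP[].
Qed.

Lemma spine_check5 : spine_check 5 6. Proof. by vm_compute. Qed.
Lemma spine_check6 : spine_check 6 5. Proof. by vm_compute. Qed.
Lemma spine_check7 : spine_check 7 5. Proof. by vm_compute. Qed.

(** The length of a thread, chosen so that the girth bound is five times it plus one. The values 8
    and 7 are those verified by computation; from seven colours on, each colour adds one vertex. *)
Definition spine_size k := if k == 5 then 8 else maxn 7 k.

Lemma spine_extend (T : finType) k : 4 < k -> spine_extendable T k (spine_size k).-1.
Proof.
move=> k4; case: (ltngtP k 7) => [k7|k7|->]; last exact: spine_checkP spine_check7.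
  have [->|k5] := eqVneq k 5; first exact: spine_checkP spine_check5.
  by have -> : k = 6 by [lia]; exact: spine_checkP spine_check6.
elim: k k7 k4 => // k IH; rewrite ltnS leq_eqVlt => /orP[/eqP <- _|k7 _].
  exact: spine_step (spine_checkP spine_check7).
have := spine_step _ (IH k7 _); rewrite /spine_size !gtn_eqF //=; try lia.
by rewrite /maxn !ifT; try lia; case: k IH k7 => // k _ k7; apply; lia.
Qed.

(** * Connected sets in the grid and branch sets *)

Definition rel_inside (T : finType) (e : rel T) (S : {set T}) : rel T :=
  [rel x y | [&& e x y, x \in S & y \in S]].

Definition grid n : finType := ('I_n.+1 * 'I_n.+1)%type.

Definition next_to (i j : nat) := (i.+1 == j) || (j.+1 == i).

Definition grid_adj n : rel (grid n) := fun p q =>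
  (p.1 == q.1) && next_to p.2 q.2 || (p.2 == q.2) && next_to p.1 q.1.

Lemma next_to_sym i j : next_to i j = next_to j i.
Proof. exact: orbC. Qed.

Lemma next_to_close i j : i <= j.+1 -> j <= i.+1 -> i != j -> next_to i j.
Proof. by rewrite /next_to; lia. Qed.

Lemma grid_adj_sym n : symmetric (@grid_adj n).
Proof.
move=> p q; rewrite /grid_adj ![_ == (q : grid n).1]eq_sym ![_ == (q : grid n).2]eq_sym.
by rewrite !(next_to_sym (q.1)) !(next_to_sym (q.2)).
Qed.

Section Inside.
Variables (T : finType) (e : rel T).
Hypothesis sym_e : symmetric e.

Lemma rel_inside_sym S : symmetric (rel_inside e S).
Proof. by move=> x y; rewrite /rel_inside /= sym_e [(x \in S) && _]andbC. Qed.

Lemma connect_inside_in (S : {set T}) x y : connect (rel_inside e S) x y -> x \in S -> y \in S.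
Proof.
move=> /connectP[p + ->]; elim: p x => //= z p IH x /andP[/and3P[_ _ zS] pz] _.
exact: IH.
Qed.

Lemma connect_inside_sub (S S' : {set T}) x y : S \subset S' ->
  connect (rel_inside e S) x y -> connect (rel_inside e S') x y.
Proof.
move=> /subsetP sSS'; apply: connect_sub => u v /and3P[euv uS vS].
by apply: connect1; rewrite /rel_inside /= euv !sSS'.
Qed.

Lemma connect_inside_reach (S : {set T}) x y : connect (rel_inside e S) x y ->
  connect (rel_inside e [set z | connect (rel_inside e S) x z]) x y.
Proof.
move=> /connectP[p]; elim/last_ind: p y => [|p z IH] y; first by move=> _ ->.
rewrite rcons_path last_rcons => /andP[xp step] ->.
have conn : connect (rel_inside e S) x (last x p) by apply/connectP; exists p.
apply: connect_trans (IH _ xp erefl) (connect1 _).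
case/and3P: (step) => ez _ _; rewrite /rel_inside /= ez !inE conn.
exact: connect_trans conn (connect1 step).
Qed.

Lemma connect_exit (S X : {set T}) x y : connect (rel_inside e S) x y -> x \notin X -> y \in X ->
  x \in S ->
  exists u v, [/\ connect (rel_inside e (S :\: X)) x u, u \in S :\: X, v \in S :&: X & e u v].
Proof.
move=> /connectP[p + ->]; elim: p x => [|z p IH] x /=; first by move=> _ /negbTE->.
move=> /andP[/and3P[exz _ zS] pz] xX lastX xS.
have [zX|zX] := boolP (z \in X).
  by exists x, z; rewrite connect0 !inE xX xS zX zS.
have [u [v [xu uS vX euv]]] := IH z pz zX lastX zS.
exists u, v; split=> //; apply: connect_trans xu; apply: connect1.
by rewrite /rel_inside /= exz !inE xX xS zX zS.
Qed.

(** Separates the overlapping pixel sets of the two halves of an arc. [X] is the component of [a] in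
    [N0] and [Y] that of [b] in the rest of [N1]; a walk from [b] to [m] has to enter [X], and its
    first step into [X] is the joining edge. *)
Lemma split_connection (N0 N1 : {set T}) a m b :
  a \in N0 -> connect (rel_inside e N0) a m -> m \in N1 -> connect (rel_inside e N1) m b -> b \notin N0 ->
  exists X Y : {set T}, [/\ X \subset N0 /\ Y \subset N1, a \in X /\ b \in Y, [disjoint X & Y],
    {in X, forall x, connect (rel_inside e X) a x} /\ {in Y, forall y, connect (rel_inside e Y) b y}
    & exists x y, [/\ x \in X, y \in Y & e x y]].
Proof.
move=> aN0 am mN1 mb bN0.
pose X := [set x | connect (rel_inside e N0) a x].
have sX : X \subset N0 by apply/subsetP => x; rewrite inE => /connect_inside_in; apply.
have bX : b \notin X by apply: contra bN0 => /(subsetP sX).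
have bN1 := connect_inside_in mb mN1.
have bm : connect (rel_inside e N1) b m.
  by rewrite (sym_connect_sym (rel_inside_sym N1)).
have mX : m \in X by rewrite inE.
have [u [v [bu uS /setIP[_ vX] euv]]] := connect_exit bm bX mX bN1.
pose Y := [set y | connect (rel_inside e (N1 :\: X)) b y].
have sY : Y \subset N1 :\: X.
  by apply/subsetP => y; rewrite inE => /connect_inside_in; apply; rewrite inE bX.
exists X, Y; split.
- by split=> //; apply: subset_trans sY (subsetDl _ _).
- by rewrite !inE !connect0.
- rewrite disjoint_sym disjoint_subset; apply: subset_trans sY _.
  by apply/subsetP => y; rewrite inE => /andP[].
- by split=> x; rewrite inE => /connect_inside_reach.
- by exists v, u; rewrite sym_e; split=> //; rewrite inE.
Qed.

End Inside.

Section Branches.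
Variables (P V I : finType) (e : rel P) (endpoint : I -> bool -> V).
Variables (N : I -> bool -> {set P}) (at_ : V -> P).
Hypotheses (sym_e : symmetric e)
  (joined : forall A, exists m,
    [/\ at_ (endpoint A false) \in N A false,
        connect (rel_inside e (N A false)) (at_ (endpoint A false)) m,
        m \in N A true & connect (rel_inside e (N A true)) m (at_ (endpoint A true))])
  (far_end : forall A, at_ (endpoint A true) \notin N A false)
  (far_apart : forall A B b b', A != B -> endpoint A b != endpoint B b' -> [disjoint N A b & N B b']).

(** Sets belonging to different edges overlap only if they start at the same vertex, where they go
    into the same branch set; so only the two halves of one edge have to be separated. The point
    [at_ w] is a hub to which all parts at [w] are connected. *)
Lemma branch_sets : exists f : P -> option V,
  (forall x p q, f p = Some x -> f q = Some x ->
     connect (rel_inside e [set r | f r == Some x]) p q) /\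
  (forall A, exists p q, [/\ f p = Some (endpoint A false), f q = Some (endpoint A true) & e p q]).
Proof.
have halves A : exists Z : {ffun bool -> {set P}},
    [/\ forall b, Z b \subset N A b, [disjoint Z false & Z true],
        forall b x, x \in Z b -> connect (rel_inside e (Z b)) (at_ (endpoint A b)) x
      & exists x y, [/\ x \in Z false, y \in Z true & e x y]].
  have [m [aN am mN mb]] := joined A.
  have [X [Y [[sX sY] [aX bY] dXY [cX cY] ex]]] := split_connection sym_e aN am mN mb (far_end A).
  exists [ffun b => if b then Y else X]; rewrite !ffunE.
  by split=> // [[]|[] x]; rewrite ffunE //; [apply: cY | apply: cX].
have [Z hZ] := fin_all_exists halves.
pose B w := \bigcup_(Ab | endpoint Ab.1 Ab.2 == w) Z Ab.1 Ab.2.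
have uniqB w w' p : p \in B w -> p \in B w' -> w = w'.
  move=> /bigcupP[[A b] /= /eqP <- pA] /bigcupP[[A' b'] /= /eqP <- pA'].
  have [sA dA _ _] := hZ A; have [sA' _ _ _] := hZ A'.
  apply/eqP; apply: contraT => ne.
  have [AA|AA] := eqVneq A A'; last first.
    have := disjointFr (far_apart AA ne) (subsetP (sA b) _ pA).
    by rewrite (subsetP (sA' b') _ pA').
  rewrite -AA in pA' ne; case: b b' pA pA' ne => -[] pA pA'; rewrite ?eqxx //.
    by rewrite (disjointFl dA pA) in pA'.
  by rewrite (disjointFr dA pA) in pA'.
pose f p := [pick w | p \in B w].
have fP p w : (f p == Some w) = (p \in B w).
  rewrite /f; case: pickP => [w' pw'|none].
    by apply/eqP/idP => [[<-] //|pw]; rewrite (uniqB _ _ _ pw pw').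
  by apply/esym/none.
have fE w : [set r | f r == Some w] = B w by apply/setP => r; rewrite inE fP.
exists f; split=> [x p q /eqP + /eqP|A].
  rewrite !fP fE => px qx.
  suff hub r : r \in B x -> connect (rel_inside e (B x)) (at_ x) r.
    apply: connect_trans (hub q qx).
    by rewrite (sym_connect_sym (rel_inside_sym sym_e _)) hub.
  case/bigcupP => -[A b] /= Ax rA; have [_ _ conn _] := hZ A.
  rewrite -(eqP Ax); apply: connect_inside_sub (conn _ _ rA).
  exact: (bigcup_sup (A, b)).
have [_ _ _ [p [q [pZ qZ epq]]]] := hZ A.
exists p, q; split=> //; apply/eqP; rewrite fP; apply/bigcupP.
  by exists (A, false).
by exists (A, true).
Qed.

End Branches.

(** * Plane maps, contraction and deletion *)

Section Incidence.
Variable D : finType.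

(** Incidence modulo two: a loop is incident with no vertex. *)
Definition incident (T : eqType) (e : bool -> D -> T) x d := (e false d == x) (+) (e true d == x).

Definition merge (T : eqType) (x y : T) (e : bool -> D -> T) b d := if e b d == x then y else e b d.

Lemma incident_merge (T : eqType) (e : bool -> D -> T) x y z d : x != y ->
  incident (merge x y e) z d = incident e z d (+) (((z == x) (+) (z == y)) && incident e x d).
Proof.
move=> xy; rewrite /incident /merge; move: (e false d) (e true d) => u v.
have [->|uz] := eqVneq u x; have [->|vx] := eqVneq v x; rewrite ?andbF ?addbF //=.
- by rewrite [x == z]eq_sym [y == z]eq_sym !addbb.
- rewrite andbT [x == z]eq_sym [y == z]eq_sym.
  by case: (z == x); case: (z == y); case: (v == z).
- rewrite andbT [x == z]eq_sym [y == z]eq_sym.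
  by case: (z == x); case: (z == y); case: (u == z).
Qed.

Lemma sum_incident (T : finType) (e : bool -> D -> T) (X : {set T}) d :
  \big[addb/false]_(x in X) incident e x d = (e false d \in X) (+) (e true d \in X).
Proof.
have one y : \big[addb/false]_(x in X) (y == x) = (y \in X).
  have [yX|yX] := boolP (y \in X).
    rewrite (bigD1 y) //= eqxx big1 ?addbF // => x /andP[_ xy].
    by rewrite eq_sym (negbTE xy).
  by rewrite big1 // => x xX; apply: contraNF yX => /eqP->.
by rewrite big_split /= !one.
Qed.

Lemma sum_even_witness (A : {set D}) (h : D -> bool) d :
  \big[addb/false]_(x in A) h x = false -> d \in A -> h d -> exists2 d', d' \in A :\ d & h d'.
Proof.
move=> sum0 dA hd; apply/exists_inP; apply: contraT => /exists_inPn none.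
move: sum0; rewrite (big_setD1 d) //= hd big1 // => x xA.
exact/negbTE/none.
Qed.

End Incidence.

Section PlaneMap.
Variables P Q D : finType.

(* A plane multigraph with vertices LV, faces LF and edges LD, the edge d having
   the ends e b d and the sides s b d. Evenness says that face boundaries are
   cycles; like the Euler inequality it is self-dual, so that deletion is dual to
   contraction. *)
Record plane_map (LV : {set P}) (LF : {set Q}) (LD : {set D})
    (e : bool -> D -> P) (s : bool -> D -> Q) : Prop := PlaneMap {
  map_ends : forall d b, d \in LD -> e b d \in LV;
  map_sides : forall d b, d \in LD -> s b d \in LF;
  map_even : forall p q, \big[addb/false]_(d in LD) (incident e p d && incident s q d) = false;
  map_euler : #|LD| + 2 <= #|LV| + #|LF|;
  map_faces_connected : forall X : {set Q},
    (exists2 q, q \in LF & q \in X) -> (exists2 q, q \in LF & q \notin X) ->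
    exists2 d, d \in LD & (s false d \in X) (+) (s true d \in X) }.

(** Modulo two, merging the ends of [d] adds their incidence vectors, and [d] becomes a loop, which
    contributes nothing. *)
Lemma even_merge (P' Q' : finType) (LD : {set D}) (e : bool -> D -> P') (s : bool -> D -> Q') d :
  (forall p q, \big[addb/false]_(d in LD) (incident e p d && incident s q d) = false) ->
  d \in LD -> e false d != e true d ->
  forall p q, \big[addb/false]_(d' in LD :\ d)
    (incident (merge (e false d) (e true d) e) p d' && incident s q d') = false.
Proof.
move=> even dLD ne p q; set x := e false d; set y := e true d.
have zero : \big[addb/false]_(d' in LD) (incident (merge x y e) p d' && incident s q d') = false.
  under eq_bigr do rewrite incident_merge // andb_addl.
  rewrite big_split /= even; case: ((p == x) (+) (p == y)) => /=; last by rewrite big1.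
  by rewrite even.
have zd : incident (merge x y e) p d = false.
  by rewrite /incident /merge -/x -/y eqxx if_same addbb.
by move: zero; rewrite (big_setD1 d) //= zd.
Qed.

Lemma plane_map_contract LV LF LD e s d : plane_map LV LF LD e s -> d \in LD ->
  e false d != e true d ->
  plane_map (LV :\ e false d) LF (LD :\ d) (merge (e false d) (e true d) e) s.
Proof.
move=> [ends sides even euler conn] dLD ne; split.
- move=> d' b /setD1P[_ d'LD]; rewrite /merge; case: eqP => [_|/eqP ne']; rewrite !inE.
    by rewrite eq_sym ne ends.
  by rewrite ne' ends.
- by move=> d' b /setD1P[_]; apply: sides.
- exact: even_merge.
- by have := cardsD1 (e false d) LV; have := cardsD1 d LD; rewrite dLD ends //; move: euler; clear; lia.
(* If the edge crossing [X] is the contracted one, evenness at its end [e false d], summed over the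
   faces in [X], yields another crossing edge. *)
move=> X inX outX; have [d' d'LD cross] := conn X inX outX.
have [dd|nd] := eqVneq d' d; last by exists d'; rewrite // !inE nd.
have evenX : \big[addb/false]_(d in LD)
    (incident e (e false d') d && ((s false d \in X) (+) (s true d \in X))) = false.
  under eq_bigr do rewrite -sum_incident big_distrr /=.
  by rewrite exchange_big /= big1.
have [|d2 d2LD /andP[_ c2]] := sum_even_witness evenX d'LD; last by exists d2; rewrite -?dd.
by rewrite cross andbT dd /incident eqxx eq_sym (negbTE ne).
Qed.

(** An edge with one face on both sides is dropped without touching the faces, which only makes the
    Euler inequality slacker; otherwise deletion is contraction in the dual. *)
Lemma plane_map_delete LV LF LD e s d : plane_map LV LF LD e s -> d \in LD ->
  exists LF' s', plane_map LV LF' (LD :\ d) e s'.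
Proof.
move=> [ends sides even euler conn] dLD.
have [same|ne] := eqVneq (s false d) (s true d).
  exists LF, s; split.
  - by move=> d' b /setD1P[_]; apply: ends.
  - by move=> d' b /setD1P[_]; apply: sides.
  - move=> p q; have sd : incident s q d = false by rewrite /incident same addbb.
    by move: (even p q); rewrite (big_setD1 d) //= sd andbF.
  - by have := cardsD1 d LD; rewrite dLD; move: euler; clear; lia.
  move=> X inX outX; have [d' d'LD cross] := conn X inX outX.
  by exists d' => //; rewrite !inE d'LD andbT; apply: contraTneq cross => ->; rewrite same addbb.
exists (LF :\ s false d), (merge (s false d) (s true d) s); split.
- by move=> d' b /setD1P[_]; apply: ends.
- move=> d' b /setD1P[_ d'LD]; rewrite /merge; case: eqP => [_|/eqP ne']; rewrite !inE.
    by rewrite eq_sym ne sides.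
  by rewrite ne' sides.
- move=> p q; under eq_bigr do rewrite andbC.
  by apply: even_merge => // q' p'; rewrite -[RHS](even p' q'); apply: eq_bigr => d' _; rewrite andbC.
- by have := cardsD1 (s false d) LF; have := cardsD1 d LD; rewrite dLD sides //; move: euler; clear; lia.
move=> X [q1 /setD1P[q1d q1F] q1X] [q2 /setD1P[q2d q2F] q2X].
pose X' := [set q | (if q == s false d then s true d else q) \in X].
have [||d' d'LD cross] := conn X'.
- by exists q1; rewrite // inE (negbTE q1d).
- by exists q2; rewrite // inE (negbTE q2d).
rewrite !inE in cross; exists d' => //; rewrite !inE d'LD andbT.
by apply: contraTneq cross => ->; rewrite eqxx eq_sym (negbTE ne) addbb.
Qed.

(* Contracting the fibres of F and deleting the unselected edges between them
   leaves a plane map of the graph of selected edges. *)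
Section Minor.
Variables (V : finType) (F : P -> V) (e0 : bool -> D -> P) (Sel : {set D}).
Hypothesis sel_across : forall d, d \in Sel -> F (e0 false d) != F (e0 true d).

Lemma plane_map_minor LV LF LD e s : plane_map LV LF LD e s -> Sel \subset LD ->
  (forall b d, F (e b d) = F (e0 b d)) ->
  (forall X : {set P}, forall x, (exists p, [/\ p \in LV, p \in X & F p = x]) ->
     (exists p, [/\ p \in LV, p \notin X & F p = x]) ->
     exists d, [/\ d \in LD, F (e0 false d) = F (e0 true d) & (e false d \in X) (+) (e true d \in X)]) ->
  exists LV' LF' e' s', [/\ plane_map LV' LF' Sel e' s', forall b d, F (e' b d) = F (e0 b d),
    {in LV' &, injective F} & F @: LV' = F @: LV].
Proof.
(* [conn] says in terms of cuts that a fibre is connected by edges inside it; in this form it is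
   inherited when such an edge is contracted and when a loop is deleted. *)
have [m] := ubnP #|LD|; elim: m LV LF LD e s => // m IH LV LF LD e s lem pm sSel Fe conn.
have [sLD|] := boolP (LD \subset Sel).
  have eqLD : LD = Sel by apply/eqP; rewrite eqEsubset sLD.
  exists LV, LF, e, s; split=> //; first by rewrite -eqLD.
  move=> p p' pV p'V Fpp'; apply/eqP; apply: contraT => ne.
  have [||d [dLD same _]] := conn [set p] (F p).
  - by exists p; rewrite inE.
  - by exists p'; rewrite inE eq_sym.
  by have := sel_across (subsetP sLD _ dLD); rewrite same eqxx.
case/subsetPn => d dLD dSel.
have lem' : #|LD :\ d| < m by move: lem; rewrite (cardsD1 d) dLD.
have sSel' : Sel \subset LD :\ d.
  by apply/subsetP => d' d'S; rewrite !inE (subsetP sSel) // andbT; apply: contraNneq dSel => <-.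
have [/andP[/eqP intra ne]|simple] :=
    boolP ((F (e0 false d) == F (e0 true d)) && (e false d != e true d)).
  have Fm b d' : F (merge (e false d) (e true d) e b d') = F (e0 b d').
    by rewrite /merge; case: eqP => [E|_]; rewrite -Fe // E !Fe.
  have [X x [p [pV pX Fp]] [p' [p'V p'X Fp']]|LV' [LF' [e' [s' [pm' Fe' inj img]]]]] :=
      IH _ _ _ _ _ lem' (plane_map_contract pm dLD ne) sSel' Fm.
    pose X' := [set q | (if q == e false d then e true d else q) \in X].
    have [||d' [d'LD same cross]] := conn X' x.
    - by exists p; case/setD1P: pV => /negbTE pd pV; rewrite inE pd.
    - by exists p'; case/setD1P: p'V => /negbTE pd p'V; rewrite inE pd.
    rewrite !inE in cross; exists d'; split=> //; rewrite !inE d'LD andbT.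
    by apply: contraTneq cross => ->; rewrite eqxx eq_sym (negbTE ne) addbb.
  exists LV', LF', e', s'; split=> //; rewrite img.
  apply/eqP; rewrite eqEsubset imsetS ?subsetDl //=; apply/subsetP => _ /imsetP[p pV ->].
  have [->|pd] := eqVneq p (e false d); last by apply: imset_f; rewrite !inE pd.
  rewrite Fe intra -Fe; apply: imset_f; rewrite !inE eq_sym ne.
  exact: (map_ends pm).
have [LF2 [s2 pm2]] := plane_map_delete pm dLD.
apply: IH lem' pm2 sSel' Fe _ => X x inX outX.
have [d' [d'LD same cross]] := conn X x inX outX.
exists d'; split=> //; rewrite !inE d'LD andbT.
apply: contraNneq simple => dd; rewrite -dd same eqxx /=.
by apply: contraTneq cross => ->; rewrite addbb.
Qed.

End Minor.

End PlaneMap.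

(** * The square grid as a plane map *)

Section GridMap.
Variable n : nat.

Definition grid_edge : finType := ('I_n * 'I_n.+1 + 'I_n.+1 * 'I_n)%type.
Definition grid_face : finType := option ('I_n * 'I_n).

Definition bump_ord (b : bool) (i : 'I_n) : 'I_n.+1 :=
  if b then lift ord0 i else widen_ord (leqnSn n) i.

Lemma val_bump_ord b i : bump_ord b i = b + i :> nat.
Proof. by case: b. Qed.

Definition grid_end b (d : grid_edge) : grid n :=
  match d with inl (i, j) => (bump_ord b i, j) | inr (i, j) => (i, bump_ord b j) end.

(* Indices are shifted by one, so that the unit square above and to the right
   of (i, j) is square i.+1 j.+1; outside the grid, square is the outer face. *)
Definition square (a b : nat) : grid_face :=
  if (a, b) is (a'.+1, b'.+1) then
    if (insub a', insub b') is (Some i, Some j) then Some (i, j) else None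
  else None.

Definition grid_side b (d : grid_edge) : grid_face :=
  match d with inl (i, j) => square i.+1 (b + j) | inr (i, j) => square (b + i) j.+1 end.

Lemma square_oob a b : (a == 0) || (b == 0) || (n < a) || (n < b) -> square a b = None.
Proof.
rewrite /square; case: a b => [|a] [|b] //=.
case: (insubP 'I_n a) => // u ha _; case: (insubP 'I_n b) => // v hb _.
by rewrite !ltnS leqNgt ha leqNgt hb.
Qed.

Lemma square_in (i j : 'I_n) : square i.+1 j.+1 = Some (i, j).
Proof. by rewrite /square !valK. Qed.

(** The edges before and after the vertex [i] of a grid line have the shifted numbers [i] and
    [i.+1]; the vanishing of [k] at 0 and [n.+1] accounts for the edges missing at the border. *)
Lemma sum_bump (i : 'I_n.+1) (k : nat -> bool) : k 0 = false -> k n.+1 = false ->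
  \big[addb/false]_(i' < n) (((bump_ord false i' == i) (+) (bump_ord true i' == i)) && k i'.+1)
  = k i (+) k i.+1.
Proof.
move=> k0 kn; under eq_bigr do rewrite andb_addl.
rewrite big_split /= addbC; congr (_ (+) _).
  case: (unliftP ord0 i) => [i' ->|->].
    rewrite (bigD1 i') //= eqxx big1 ?addbF // => j ji.
    by rewrite (inj_eq lift_inj) (negbTE ji).
  by rewrite k0 big1 // => j _; rewrite eq_sym (negbTE (neq_lift _ _)).
have [ilt|ige] := ltnP i n.
  rewrite (bigD1 (Ordinal ilt)) //= -val_eqE /= eqxx big1 ?addbF // => j ji.
  by rewrite -val_eqE /=; case: eqP => // E; case/eqP: ji; apply: val_inj.
have -> : i = n :> nat by apply/eqP; rewrite eqn_leq ige -ltnS ltn_ord.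
rewrite kn big1 // => j _; rewrite -val_eqE /=; case: eqP => // E.
by move: ige; rewrite -E leqNgt ltn_ord.
Qed.

Lemma grid_plane_map : plane_map [set: grid n] [set: grid_face] [set: grid_edge] grid_end grid_side.
Proof.
split.
- by move=> *; rewrite inE.
- by move=> *; rewrite inE.
- case=> i j q; pose h a b := square a b == q.
  under eq_bigl do rewrite inE.
  have sum_sum (f : grid_edge -> bool) : \big[addb/false]_d f d =
      (\big[addb/false]_(j' < n.+1) \big[addb/false]_(i' < n) f (inl (i', j'))) (+)
      (\big[addb/false]_(i' < n.+1) \big[addb/false]_(j' < n) f (inr (i', j'))).
    rewrite big_sumType /= exchange_big !pair_bigA /=.
    by congr addb; apply: eq_bigr => -[].
  rewrite sum_sum (bigD1 j) //=. rewrite [X in _ (+) X (+) _]big1 ?addbF; last first.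
    move=> j' jj; rewrite big1 // => i' _.
    by rewrite /incident /= !xpair_eqE (negbTE jj) !andbF.
  rewrite (bigD1 i (P := predT)) //= [X in _ (+) (_ (+) X)]big1 ?addbF; last first.
    move=> i' ii; rewrite big1 // => j' _.
    by rewrite /incident /= !xpair_eqE (negbTE ii).
  under eq_bigr do rewrite /incident /= !xpair_eqE eqxx !andbT.
  under [X in _ (+) X]eq_bigr do rewrite /incident /= !xpair_eqE eqxx !andTb.
  have zero a b a' b' : (a == 0) || (b == 0) || (n < a) || (n < b) ->
      (a' == 0) || (b' == 0) || (n < a') || (n < b') -> h a b (+) h a' b' = false.
    by rewrite /h => /square_oob-> /square_oob->; rewrite addbb.
  rewrite (@sum_bump i (fun a => h a j (+) h a j.+1)); try by apply: zero; rewrite ?eqxx ?leqnn ?orbT.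
  rewrite (@sum_bump j (fun b => h i b (+) h i.+1 b)); try by apply: zero; rewrite ?eqxx ?leqnn ?orbT.
  (* Each of the four squares around a vertex borders two of its four edges. *)
  by case: (h i j); case: (h i.+1 j); case: (h i j.+1); case: (h i.+1 j.+1).
- by rewrite !cardsT card_sum card_option !card_prod !card_ord; lia.
move=> X [q1 _ q1X] [q2 _ q2X]; apply/exists_inP; apply: contraT => /exists_inPn none.
have const q : (q \in X) = (None \in X).
  case: q => [[i j]|//]; rewrite -square_in.
  have : forall b, b <= n -> (square i.+1 b \in X) = (None \in X).
    elim=> [|b IH] bn; first by rewrite square_oob.
    have : ~~ ((square i.+1 b \in X) (+) (square i.+1 b.+1 \in X)).
      exact: none (inl (i, Ordinal (leqW bn))) (in_setT _).
    by rewrite IH ?(ltnW bn) //; case: (_ \in X); case: (None \in X).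
  by apply; exact: ltn_ord.
by rewrite const -(const q1) q1X in q2X.
Qed.

Lemma grid_adj_edge (p q : grid n) : grid_adj p q ->
  exists d b, grid_end b d = p /\ grid_end (~~ b) d = q.
Proof.
case: p q => [i j] [i' j'].
have next (k k' : 'I_n.+1) : next_to k k' -> exists m b, bump_ord b m = k /\ bump_ord (~~ b) m = k'.
  case/orP => /eqP E.
    have lt : k < n by rewrite -ltnS E ltn_ord.
    exists (Ordinal lt), false; split; apply: ord_inj; rewrite val_bump_ord /= ?add1n ?add0n //.
  have lt : k' < n by rewrite -ltnS E ltn_ord.
  exists (Ordinal lt), true; split; apply: ord_inj; rewrite val_bump_ord /= ?add1n ?add0n //.
case/orP => /andP[/eqP /= <- /next[m [b [<- <-]]]].
  by exists (inr (i, m)), b.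
by exists (inl (m, j)), b.
Qed.

End GridMap.

Lemma grid_connected n (p q : grid n) : connect (@grid_adj n) p q.
Proof.
have conn0 m : forall p : grid n, p.1 + p.2 = m -> connect (@grid_adj n) p (ord0, ord0).
  elim: m => [|m IH] [i j] /= ij.
    have -> : (i, j) = (ord0, ord0) by congr pair; apply: val_inj => /=; lia.
    exact: connect0.
  case: (posnP i) => [i0|i0].
    have j0 : 0 < j by lia.
    have vj : (inord j.-1 : 'I_n.+1) = j.-1 :> nat by rewrite inordK // (leq_ltn_trans (leq_pred _)).
    apply: (connect_trans (connect1 (y := (i, inord j.-1)) _)); last by apply: IH; rewrite /= vj; lia.
    by rewrite /grid_adj /next_to /= eqxx vj (prednK j0) eqxx orbT.
  have vi : (inord i.-1 : 'I_n.+1) = i.-1 :> nat by rewrite inordK // (leq_ltn_trans (leq_pred _)).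
  apply: (connect_trans (connect1 (y := (inord i.-1, j)) _)); last by apply: IH; rewrite /= vi; lia.
  by rewrite /grid_adj /next_to /= eqxx vi (prednK i0) eqxx !orbT.
apply: connect_trans (conn0 _ p erefl) _.
by rewrite (sym_connect_sym (@grid_adj_sym n)) (conn0 _ q erefl).
Qed.

(** * Faces of a graph that is a minor of a grid *)

(** Contraction needs every grid point in a branch set. By connectedness some unassigned point has
    an assigned neighbour, whose set it joins. *)
Lemma extend_fibres (P V : finType) (e : rel P) (f : P -> option V) p0 x0 :
  symmetric e -> (forall p q, connect e p q) -> f p0 = Some x0 ->
  (forall x p q, f p = Some x -> f q = Some x -> connect (rel_inside e [set r | f r == Some x]) p q) ->
  exists F : P -> V, [/\ forall p x, f p = Some x -> F p = x, forall p, exists q, f q = Some (F p)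
    & forall p q, F p = F q -> connect (rel_inside e [set r | F r == F p]) p q].
Proof.
move=> sym_e conn; have [m] := ubnP #|[set p | f p == None]|.
elim: m f => // m IH f lem fp0 fconn.
have [tot|[p1 fp1]] : (forall p, f p != None) \/ exists p, f p == None.
  by case: (pickP (fun p => f p == None)) => [p ?|none]; [right; exists p | left => p; rewrite none].
  have fF p : f p = Some (odflt x0 (f p)) by case: (f p) (tot p).
  exists (fun p => odflt x0 (f p)); split=> [p x ->|p|p q E] //; first by exists p.
  have eqS : [set r | odflt x0 (f r) == odflt x0 (f p)] = [set r | f r == Some (odflt x0 (f p))].
    by apply/setP => r; rewrite !inE [in RHS]fF.
  by rewrite eqS; apply: fconn; rewrite // E.
have connT : connect (rel_inside e setT) p0 p1.
  by rewrite (eq_connect (e' := e)) // => u v; rewrite /rel_inside /= !inE !andbT.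
have [|||u [v [_ uX /setIP[_ vX] euv]]] := @connect_exit _ e setT [set p | f p == None] p0 p1 connT.
- by rewrite inE fp0.
- by rewrite inE.
- by rewrite inE.
rewrite !inE in uX vX; rewrite andbT in uX; pose f' p := if p == v then f u else f p.
have f'u : f' u = f u by rewrite /f'; case: ifP.
have ff' p x : f p = Some x -> f' p = Some x.
  by rewrite /f'; case: eqP => // -> fv; rewrite fv in vX.
have subf x : [set r | f r == Some x] \subset [set r | f' r == Some x].
  by apply/subsetP => r; rewrite !inE => /eqP/ff'->.
have lem' : #|[set p | f' p == None]| < m.
  apply: leq_trans (_ : #|[set p | f p == None]| <= m); last by rewrite -ltnS.
  apply: proper_card; apply/properP; split; last by exists v; rewrite inE // /f' eqxx.
  by apply/subsetP => r; rewrite !inE /f'; case: (r =P v) => // ->.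
have back p x : f' p = Some x ->
    exists2 p', f p' = Some x & connect (rel_inside e [set r | f' r == Some x]) p p'.
  rewrite {1}/f'; case: eqP => [-> fu|_ fp]; last by exists p.
  exists u => //; apply: connect1; rewrite /rel_inside /= sym_e euv !inE f'u fu eqxx.
  by rewrite /f' eqxx fu eqxx.
have [|x p q f'p f'q|F [Ff' imF Fconn]] := IH f' lem'.
- exact: ff'.
- have [p' fp' pp'] := back p x f'p; have [q' fq' qq'] := back q x f'q.
  apply: connect_trans pp' _; rewrite (sym_connect_sym (rel_inside_sym sym_e _)).
  apply: connect_trans qq' _; rewrite (sym_connect_sym (rel_inside_sym sym_e _)).
  exact: connect_inside_sub (subf x) (fconn x p' q' fp' fq').
exists F; split=> // [p x /ff'/Ff' //|p].
by have [q /back[q' fq' _]] := imF p; exists q'.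
Qed.

(** [bd q] stands for the edges with the face [q] on exactly one side; it is an even subgraph, not
    necessarily a single cycle. The fourth clause is twice the Euler inequality: the degree sum
    replaces twice the number of edges, and isolated vertices are left out. *)
Definition has_faces (V : finType) (e : rel V) :=
  exists (Q : finType) (LF : {set Q}) (bd : Q -> rel V),
  [/\ forall q, symmetric (bd q) /\ subrel (bd q) e,
      forall q x, \big[addb/false]_y bd q x y = false,
      forall x y, #|[set q in LF | bd q x y]| <= 2,
      \sum_x #|[set y | e x y]| + 4 <= 2 * #|LF| + 2 * #|[set x | [exists y, e x y]]|
    & 1 < #|LF| -> forall q, q \in LF -> exists x y, bd q x y].

Section Faces.
Variables (V : finType) (e : rel V) (n : nat) (f : grid n -> option V).
Hypotheses (sym_e : symmetric e) (irr_e : irreflexive e) (nonempty : exists x y, e x y)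
  (fibres : forall x p q, f p = Some x -> f q = Some x ->
     connect (rel_inside (@grid_adj n) [set r | f r == Some x]) p q)
  (edges_in : forall x y, e x y -> exists p q, [/\ f p = Some x, f q = Some y & grid_adj p q]).

Let W := [set x | [exists y, e x y]].

Lemma grid_faces : has_faces e.
Proof.
have edgeW x y : e x y -> x \in W by move=> xy; rewrite inE; apply/existsP; exists y.
(* Branch sets of vertices isolated in [e] are dissolved, so that the Euler inequality counts
   vertices of [W] only. *)
pose fW p := if f p is Some x then if x \in W then Some x else None else None.
have fWP p x : (fW p == Some x) = (f p == Some x) && (x \in W).
  rewrite /fW; case: (f p) => // y; have [->|yx] := eqVneq y x.
    by case: ifP; rewrite ?eqxx.
  have ne : (Some y == Some x) = false by apply: contraNF yx => /eqP[->].
  by rewrite ne; case: ifP; rewrite ?ne.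
have [x0 [y0 xy0]] := nonempty.
have [p0 [q0 [fp0 _ _]]] := edges_in xy0.
have [|x p q|F [Ff imF Fconn]] := @extend_fibres _ _ _ fW p0 x0 (@grid_adj_sym n) (@grid_connected n).
- by apply/eqP; rewrite fWP fp0 eqxx (edgeW _ _ xy0).
- move=> /eqP; rewrite fWP => /andP[/eqP fp xW] /eqP; rewrite fWP => /andP[/eqP fq _].
  rewrite (_ : [set r | fW r == Some x] = [set r | f r == Some x]); first exact: fibres.
  by apply/setP => r; rewrite !inE fWP xW andbT.
pose e0 := @grid_end n.
have FW p : F p \in W by have [q /eqP] := imF p; rewrite fWP => /andP[].
pose joins d x y := (F (e0 false d) == x) && (F (e0 true d) == y) ||
  (F (e0 false d) == y) && (F (e0 true d) == x).
have joinsC d x y : joins d x y = joins d y x by exact: orbC.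
pose dart x y := [pick d | joins d x y].
have dartC x y : dart x y = dart y x by apply: eq_pick => d; apply: joinsC.
have dart_joins x y d : dart x y = Some d -> joins d x y.
  by rewrite /dart; case: pickP => // d' jd' [<-].
have dart_ex x y : e x y -> exists2 d, dart x y = Some d & joins d x y.
  move=> xy; have [p [q [fp fq pq]]] := edges_in xy.
  have Fp : F p = x by apply: Ff; apply/eqP; rewrite fWP fp eqxx (edgeW _ _ xy).
  have Fq : F q = y by apply: Ff; apply/eqP; rewrite fWP fq eqxx (edgeW y x) // sym_e.
  have [d [b [dp dq]]] := grid_adj_edge pq.
  have jd : joins d x y.
    by rewrite /joins /e0; case: b dp dq => /= -> ->; rewrite Fp Fq !eqxx ?orbT.
  case E : (dart x y) => [d'|]; first by exists d' => //; apply: dart_joins.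
  by move: E; rewrite /dart; case: pickP => // /(_ d); rewrite jd.
(* Of the grid edges between two branch sets, only the one picked by [dart] is selected, so that the
   minor is simple. *)
pose Sel := [set d | e (F (e0 false d)) (F (e0 true d)) &&
  (dart (F (e0 false d)) (F (e0 true d)) == Some d)].
have across d : d \in Sel -> F (e0 false d) != F (e0 true d).
  by rewrite inE => /andP[eab _]; apply: contraTneq eab => ->; rewrite irr_e.
have selP x y d : e x y -> dart x y = Some d -> d \in Sel.
  move=> xy dd; rewrite inE; case/orP: (dart_joins _ _ _ dd) => /andP[/eqP-> /eqP->].
    by rewrite xy dd eqxx.
  by rewrite sym_e xy dartC dd eqxx.
have sel_dart d x y : d \in Sel -> joins d x y -> e x y /\ dart x y = Some d.
  rewrite inE => /andP[ed /eqP dd] /orP[]/andP[/eqP<- /eqP<-]; first by [].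
  by rewrite sym_e dartC.
have [||X x [p [_ pX Fp]] [p' [_ p'X Fp']]|LV [LF [e' [s [pm Fe' injF imgF]]]]] :=
  @plane_map_minor _ _ _ V F e0 Sel across _ _ _ _ _ (grid_plane_map n).
- exact: subsetT.
- by [].
- have conn : connect (rel_inside (@grid_adj n) [set r | F r == F p]) p p' by apply: Fconn; rewrite Fp.
  have pX' : p \notin ~: X by rewrite inE negbK.
  have p'X' : p' \in ~: X by rewrite inE.
  have pS : p \in [set r | F r == F p] by rewrite inE.
  have [u [v [pu uX /setIP[Fv vX] uv]]] := connect_exit conn pX' p'X' pS.
  have [d [b [du dv]]] := grid_adj_edge uv.
  move: uX; rewrite !inE negbK => /andP[uX /eqP Fu]; rewrite inE in vX; rewrite inE in Fv.
  exists d; split; first by rewrite inE.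
    by rewrite /e0; case: b du dv => /= -> ->; rewrite Fu (eqP Fv).
  by case: b du dv => /= -> ->; rewrite uX (negbTE vX).
pose bd q x y := e x y && (if dart x y is Some d then incident s q d else false).
have bdE q x y : bd q x y = \big[addb/false]_(d in Sel) (joins d x y && incident s q d).
  rewrite /bd; have [xy|xy] := boolP (e x y); last first.
    by rewrite big1 // => d dS; case: (boolP (joins d x y)) => // /(sel_dart _ _ _ dS)[]; rewrite (negbTE xy).
  have [d dd jd] := dart_ex x y xy; rewrite dd (bigD1 d) ?(selP x y) //= jd big1 ?addbF //.
  move=> d' /andP[d'S d'd]; case: (boolP (joins d' x y)) => // /(sel_dart _ _ _ d'S)[_].
  by rewrite dd => -[E]; rewrite E eqxx in d'd.
have sum_joins d x : d \in Sel ->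
    \big[addb/false]_y joins d x y = (F (e0 false d) == x) (+) (F (e0 true d) == x).
  move=> dS; have ne := across d dS.
  have one (z : V) : \big[addb/false]_y (z == y) = true.
    by rewrite (bigD1 z) //= eqxx big1 ?addbF // => y yz; rewrite eq_sym (negbTE yz).
  have -> : \big[addb/false]_y joins d x y = \big[addb/false]_y
      (((F (e0 false d) == x) && (F (e0 true d) == y)) (+) ((F (e0 true d) == x) && (F (e0 false d) == y))).
    apply: eq_bigr => y _; rewrite /joins [(F (e0 false d) == y) && _]andbC.
    case: (F (e0 false d) =P x) => [E|_] //=; rewrite -E [F (e0 true d) == F _]eq_sym (negbTE ne) /=.
    by rewrite orbF addbF.
  by rewrite big_split /= -!big_distrr /= !one !andbT.
exists (grid_face n), LF, bd; split.
- move=> q; split=> [x y|x y /andP[] //].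
  by rewrite /bd sym_e dartC.
- move=> q x; under eq_bigr do rewrite bdE.
  rewrite exchange_big /=.
  have [/existsP[p /andP[pV /eqP Fp]]|none] := boolP [exists p, (p \in LV) && (F p == x)].
    rewrite -[RHS](map_even pm p q); apply: eq_bigr => d dS.
    rewrite -big_distrl /= sum_joins //; congr (_ && _); rewrite /incident -!Fe'.
    have eqF b : (F (e' b d) == x) = (e' b d == p).
      apply/eqP/eqP => [E|-> //]; apply: injF => //; last by rewrite E.
      exact: (map_ends pm).
    by rewrite !eqF.
  rewrite big1 // => d dS; rewrite -big_distrl /= sum_joins // -!Fe'.
  have nF b : (F (e' b d) == x) = false.
    apply: contraNF none => E; apply/existsP; exists (e' b d).
    by rewrite E (map_ends pm).
  by rewrite !nF.
- move=> x y; case E : (dart x y) => [d|].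
    apply: leq_trans (_ : #|[set s false d; s true d]| <= 2); last by rewrite cards2; case: (_ != _).
    apply/subset_leq_card/subsetP => q; rewrite !inE /bd E /incident => /and3P[_ _].
    by rewrite ![_ == q]eq_sym; case: (q == s false d).
  rewrite (_ : [set _ in _ | _] = set0) ?cards0 //; apply/setP => q.
  by rewrite !inE /bd E !andbF.
- have cLV : #|LV| <= #|W|.
    rewrite -(card_in_imset injF); apply/subset_leq_card/subsetP => _ /imsetP[p _ ->].
    exact: FW.
  suff le : \sum_x #|[set y | e x y]| <= #|Sel| * 2 by have := map_euler pm; rewrite -/W; move: le cLV; clear; lia.
  have pairs : \sum_x #|[set y | e x y]| = \sum_(xy : V * V) e xy.1 xy.2.
    rewrite -(pair_bigA _ (fun x y => e x y : nat)) /=; apply: eq_bigr => x _.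
    by rewrite -sum1dep_card big_mkcond /=; apply: eq_bigr => y _; case: (e x y).
  rewrite pairs -sum_nat_const.
  apply: (@leq_trans (\sum_(xy : V * V) \sum_(d in Sel) joins d xy.1 xy.2)).
    apply: leq_sum => -[x y] _ /=; have [xy|//] := boolP (e x y).
    have [d dd jd] := dart_ex x y xy.
    by rewrite (bigD1 d) ?(selP x y) //= jd leq_addr.
  rewrite exchange_big /=; apply: leq_sum => d dS.
  have -> : \sum_(xy : V * V) joins d xy.1 xy.2 = #|[set xy : V * V | joins d xy.1 xy.2]|.
    by rewrite -sum1dep_card [RHS]big_mkcond /=; apply: eq_bigr => xy _; case: (joins _ _ _).
  set a := F (e0 false d); set b := F (e0 true d).
  apply: leq_trans (_ : #|[set (a, b); (b, a)]| <= 2); last by rewrite cards2; case: (_ != _).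
  apply/subset_leq_card/subsetP => -[x y]; rewrite !inE !xpair_eqE /joins /= -/a -/b.
  by rewrite ![_ == a]eq_sym ![_ == b]eq_sym => /orP[]/andP[-> ->]; rewrite ?orbT.
move=> LF1 q qLF.
have [q' /andP[q'LF q'q]] : exists q', (q' \in LF) && (q' != q).
  move: LF1; rewrite (cardsD1 q) qLF add1n ltnS card_gt0 => /set0Pn[q'].
  by rewrite !inE andbC; exists q'.
have [||d dS cross] := map_faces_connected pm (X := [set q]).
- by exists q; rewrite // inE.
- by exists q'; rewrite // inE.
rewrite !inE in cross; have := dS; rewrite inE => /andP[ed /eqP dd].
by exists (F (e0 false d)), (F (e0 true d)); rewrite /bd ed dd.
Qed.

End Faces.

(** * Long threads from the Euler inequality *)

Lemma big_addb_odd (I : finType) (b : pred I) :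
  \big[addb/false]_i b i = odd #|[set i | b i]|.
Proof.
rewrite -sum1dep_card [in RHS]big_mkcond /= (big_morph odd oddD (erefl _)).
by apply: eq_bigr => i _; case: (b i).
Qed.

Section Cycles.
Variables (V : finType).

(** A path is prolonged at its head [x] by a neighbour other than [y]. Once that neighbour is on the
    path already, it lies beyond [y] and closes a cycle of length at least three. *)
Lemma cycle_of_min_degree2 (b : rel V) x0 y0 : irreflexive b -> symmetric b ->
  (forall x y, b x y -> exists2 z, b x z & z != y) -> b x0 y0 ->
  exists c, ucycle b c /\ 2 < size c.
Proof.
move=> irr sym two xy0.
suff main m : forall x y p, #|V| - size p <= m -> uniq [:: x, y & p] -> path b x (y :: p) ->
    exists c, ucycle b c /\ 2 < size c.
  by apply: (main #|V| x0 y0 [::]); rewrite ?subn0 //= ?xy0 // inE andbT; apply: contraTneq xy0 => ->; rewrite irr.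
elim: m => [|m IH] x y p le u pth.
  by have := card_uniqP u; have := max_card (mem [:: x, y & p]); move: le => /= + + E; rewrite E /=; lia.
have [z xz zy] : exists2 z, b x z & z != y by apply: two; case/andP: pth.
have [zin|zout] := boolP (z \in [:: x, y & p]); last first.
  apply: (IH z x (y :: p)); first by move: le => /=; lia.
    by rewrite cons_uniq zout u.
  by rewrite /= sym xz.
have zp : z \in p.
  by move: zin; rewrite !inE (negbTE zy) /=; case: eqP xz => [->|//]; rewrite irr.
case/splitPr: zp u pth {le zin} => p1 p2 u pth.
exists [:: x, y & rcons p1 z]; split; last by rewrite /= size_rcons.
apply/andP; split.
  move: pth; rewrite /= [path b y (rcons (rcons _ _) _)]rcons_path last_rcons [b z x]sym xz andbT.
  by rewrite cat_path rcons_path /= => /and4P[-> -> ->].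
by move: u; rewrite -cat_rcons -!cat_cons cat_uniq => /andP[].
Qed.

Lemma window_avoiding (B : pred V) L x0 m s : count B s <= m -> m.+1 * L <= size s ->
  exists2 i, i + L <= size s & forall j, j < L -> ~~ B (nth x0 s (i + j)).
Proof.
elim: m s => [|m IH] s cnt le.
  exists 0 => [|j jL]; first by lia.
  move: cnt; rewrite leqn0 eqn0Ngt -has_count => /hasPn; apply; apply: mem_nth.
  by apply: leq_trans le; rewrite mul1n.
have [fL|Lf] := ltnP (find B s) L; last first.
  exists 0 => [|j jL]; first by move: le; rewrite mulSn add0n => /(leq_trans (leq_addr _ _)).
  by rewrite add0n before_find // (leq_trans jL).
have hasB : has B s by rewrite has_find; apply: leq_trans fL _; move: le; rewrite mulSn => /(leq_trans (leq_addr _ _)).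
have [||i le' hi] := IH (drop (find B s).+1 s).
- move: cnt; rewrite -{1}(cat_take_drop (find B s) s) (drop_nth x0) -?has_find // count_cat /=.
  by rewrite (nth_find x0 hasB); lia.
- by rewrite size_drop; move: le; rewrite !mulSn; lia.
rewrite size_drop in le'.
exists ((find B s).+1 + i) => [|j jL]; first by move: le' hasB; rewrite has_find; lia.
by rewrite -addnA -nth_drop hi.
Qed.

(** Rotating a bad entry to the front leaves at most four among at least [5 * L] entries, so a
    window of length [L] is free. Position 0 is reserved for the vertex before the thread. *)
Lemma rot_avoiding (B : pred V) L x0 c : 0 < L -> count B c <= 5 -> 5 * L < size c ->
  exists i, forall j, 0 < j <= L -> ~~ B (nth x0 (rot i c) j).
Proof.
move=> L0 cnt sz; have [hasB|noB] := boolP (has B c); last first.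
  exists 0 => j jL; rewrite rot0; move/hasPn: noB; apply; apply: mem_nth.
  by apply: leq_ltn_trans sz; case/andP: jL L0; clear; lia.
pose k := find B c; have kc : k < size c by rewrite -has_find.
have rotE : rot k c = nth x0 c k :: (drop k.+1 c ++ take k c) by rewrite /rot (drop_nth x0).
have [||i le hi] := @window_avoiding B L x0 4 (drop k.+1 c ++ take k c).
- have : count B (rot k c) <= 5 by rewrite /rot count_cat addnC -count_cat cat_take_drop.
  by rewrite rotE /= (nth_find x0 hasB).
- have : 5 * L < size (rot k c) by rewrite size_rot.
  by rewrite rotE.
exists (rot_add c k i) => j /andP[j0 jL]; rewrite -rot_rot_add rotE.
set t := drop k.+1 c ++ take k c in le hi *.
have -> : nth x0 (rot i (nth x0 c k :: t)) j = nth x0 (nth x0 c k :: t) (i + j).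
  rewrite /rot nth_cat nth_drop size_drop /= ifT //; lia.
by case: j j0 jL => // j _ jL; rewrite addnS /= hi.
Qed.

Variable e : rel V.
Hypotheses (irr_e : irreflexive e) (faces : has_faces e).
Let dg x := #|[set y | e x y]|.
Hypotheses (min_degree : forall x y, e x y -> 1 < dg x).
Hypotheses (nonempty : exists x y, e x y).

(* Without a long thread, each face boundary has at least six branch vertices,
   whereas Euler's formula bounds their average number below six. *)
Lemma long_thread L : 0 < L -> (forall c, ucycle e c -> 2 < size c -> 5 * L < size c) ->
  exists c x0, [/\ ucycle e c, 5 * L < size c & forall j, 0 < j <= L -> dg (nth x0 c j) = 2].
Proof.
move=> L0 girth; have [x0 [y0 xy0]] := nonempty.
have [Q [LF [bd [bdP even two euler conn]]]] := faces.
pose B v := 2 < dg v; pose W := [set x | [exists y, e x y]].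
have euler' : \sum_v dg v + 4 <= 2 * #|LF| + 2 * #|W| := euler.
have degW v : v \in W -> 1 < dg v by rewrite inE => /existsP[y]; apply: min_degree.
(* With [euler'], the sum of [dg v - 2] over [W], increased by 4, is at most [2 * #|LF|]. *)
have sumW : \sum_(v in W) (dg v - 2) + 2 * #|W| <= \sum_v dg v.
  rewrite mulnC -sum_nat_const -big_split /= [leqRHS](bigID (mem W)) /=.
  apply: leq_trans (leq_addr _ _); apply: leq_sum => v /degW; lia.
have LF1 : 1 < #|LF|.
  have : 0 < #|W| by apply/card_gt0P; exists x0; rewrite inE; apply/existsP; exists y0.
  by move: euler' sumW; move: (\sum_v dg v) (\sum_(v in W) _) => a b; clear; lia.
pose bdeg q v := #|[set y | bd q v y]|.
have bdeg2 q v y : bd q v y -> 1 < bdeg q v.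
  move=> vy; have := even q v; rewrite big_addb_odd -/(bdeg q v).
  have : 0 < bdeg q v by apply/card_gt0P; exists y; rewrite inE.
  by case: (bdeg q v) => [|[|]].
have cycles q : exists c, q \in LF -> ucycle (bd q) c /\ 2 < size c.
  have [qLF|] := boolP (q \in LF); last by exists [::].
  have [symq subq] := bdP q; have [x [y xy]] := conn LF1 q qLF.
  have [|u v uv|c hc] := @cycle_of_min_degree2 (bd q) x y _ symq _ xy; last by exists c.
    by move=> u; apply: contraFF (irr_e u) => /subq.
  have := bdeg2 q u v uv; rewrite /bdeg (cardsD1 v) inE uv add1n ltnS card_gt0.
  by case/set0Pn => z; rewrite !inE => /andP[zv uz]; exists z.
have [cyc hcyc] := fin_all_exists cycles.
have ecyc q : q \in LF -> ucycle e (cyc q) /\ 2 < size (cyc q).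
  move=> /hcyc[/andP[pc uc] sc]; split=> //; apply/andP; split=> //.
  by apply: sub_cycle pc; case: (bdP q).
have [/exists_inP[q qLF few]|many] := boolP [exists q in LF, count B (cyc q) <= 5].
  have [uc sc] := ecyc q qLF; have long := girth _ uc sc.
  have [i hi] := rot_avoiding x0 L0 few long.
  exists (rot i (cyc q)), x0; split; last move=> j jL.
  - by rewrite rot_ucycle.
  - by rewrite size_rot.
  have := hi j jL; rewrite /B -leqNgt => le; apply/eqP; rewrite eqn_leq le /=.
  have pc : cycle e (rot i (cyc q)) by rewrite rot_cycle; case/andP: uc.
  apply: (@min_degree _ (next (rot i (cyc q)) (nth x0 (rot i (cyc q)) j))).
  by apply: next_cycle pc _; apply: mem_nth; rewrite size_rot; lia.
(* Six branch vertices on the cycle, each of boundary degree at least two. *)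
have per_face q : q \in LF -> 12 <= \sum_(v | B v) bdeg q v.
  move=> qLF; have [/andP[pc uc] _] := hcyc q qLF.
  have cnt : 5 < count B (cyc q).
    by rewrite ltnNge; apply: contra many => few; apply/exists_inP; exists q.
  apply: (@leq_trans (\sum_(v in [set v in cyc q | B v]) 2)).
    rewrite sum_nat_const (_ : #|_| = count B (cyc q)); first by lia.
    rewrite -size_filter -(card_uniqP (filter_uniq B uc)).
    by apply: eq_card => v; rewrite in_set mem_filter andbC.
  rewrite [leqRHS](bigID (mem (cyc q))) /=; apply: leq_trans (leq_addr _ _).
  rewrite (eq_bigl (fun v => B v && (v \in cyc q))); last by move=> v; rewrite inE andbC.
  apply: leq_sum => v /andP[_ vc]; apply: (bdeg2 q v (next (cyc q) v)).
  exact: next_cycle.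
have up : #|LF| * 12 <= \sum_(v | B v) 2 * dg v.
  rewrite -sum_nat_const; apply: (@leq_trans (\sum_(q in LF) \sum_(v | B v) bdeg q v)).
    exact: leq_sum.
  rewrite exchange_big /=; apply: leq_sum => v _.
  have -> : \sum_(q in LF) bdeg q v = \sum_y #|[set q in LF | bd q v y]|.
    under eq_bigr do rewrite /bdeg -sum1dep_card big_mkcond /=.
    rewrite exchange_big /=; apply: eq_bigr => y _.
    by rewrite -sum1dep_card [RHS]big_mkcondr.
  apply: (@leq_trans (\sum_(y in [set y | e v y]) 2)); last by rewrite sum_nat_const mulnC.
  rewrite [leqRHS]big_mkcond /=; apply: leq_sum => y _; rewrite inE; case: ifP => [_|evy]; first exact: two.
  rewrite leqn0 cards_eq0; apply/eqP/setP => q; rewrite !inE.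
  by apply: contraFF evy => /andP[_]; case: (bdP q) => _; apply.
(* [2 * d <= 6 * (d - 2)] holds from [d = 3] on. Together the bounds give
   [12 * #|LF| + 24 <= 12 * #|LF|]. *)
have low : \sum_(v | B v) 2 * dg v <= 6 * \sum_(v in W) (dg v - 2).
  rewrite big_distrr /= [leqRHS](bigID B) /=; apply: leq_trans (leq_addr _ _).
  rewrite [leqRHS](eq_bigl B) => [|v]; last first.
    rewrite andb_idl // => Bv; have : 0 < dg v by apply: leq_trans Bv.
    by case/card_gt0P => y; rewrite !inE => vy; apply/existsP; exists y.
  by apply: leq_sum => v; rewrite /B; lia.
have := leq_trans up low; move: euler' sumW; move: (\sum_v dg v) (\sum_(v in W) _) => a b; clear; lia.
Qed.

End Cycles.

(** * Strong colourings: removing leaves and recolouring threads *)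

Lemma spine_ext_seq (T : finType) (U C C' : {set T}) c c' ds : spine_ext U C c ds C' c' ->
  exists (D : nat -> {set T}) (o : nat -> T),
  [/\ D 0 = C /\ D (size ds) = C', o 0 = c /\ o (size ds).+1 = c',
      forall j, j < size ds -> #|D j.+1| = nth 0 ds j,
      forall j, j < size ds -> D j :&: D j.+1 = [set o j.+1]
    & forall j, j <= size ds -> o j != o j.+1].
Proof.
elim: ds C c => [|d ds IH] C c /=.
  case=> <- cc'; exists (fun=> C), (fun j => if j is 0 then c else c').
  by split=> // -[].
case=> o1 [D1 [/setD1P[o1c o1C] cD sD CD /IH[D [o [[D0 Dn] [o0 on] cards meets neq]]]]].
exists (fun j => if j is j'.+1 then D j' else C), (fun j => if j is j'.+1 then o j' else c).
split=> //.
- by case=> [|j] jlt /=; [rewrite D0 | apply: cards].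
- by case=> [|j] jlt /=; [rewrite D0 o0 | apply: meets].
- by case=> [|j] jle /=; [rewrite o0 eq_sym | apply: neq].
Qed.

(** Colours the edges at a thread vertex from its colour set: the two spine edges have prescribed
    colours, the leaves take the others. *)
Lemma inject_two_points (V T : finType) (A : {set V}) (C : {set T}) a b s t :
  #|A| = #|C| -> a \in A -> b \in A -> a != b -> s \in C -> t \in C -> s != t ->
  exists h : V -> T, [/\ {in A &, injective h}, {in A, forall x, h x \in C}, h a = s & h b = t].
Proof.
move=> AC aA bA ab sC tC st.
pose la := [:: a, b & enum (A :\ a :\ b)]; pose lc := [:: s, t & enum (C :\ s :\ t)].
have mem_la x : (x \in la) = (x \in A).
  rewrite !inE mem_enum !inE; case: (x =P a) => [->|_] /=; first by rewrite aA.
  by case: (x =P b) => [->|_]; rewrite ?bA.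
have mem_lc x : (x \in lc) = (x \in C).
  rewrite !inE mem_enum !inE; case: (x =P s) => [->|_] /=; first by rewrite sC.
  by case: (x =P t) => [->|_]; rewrite ?tC.
have ula : uniq la by rewrite /= inE !mem_enum !inE (negbTE ab) !eqxx andbF enum_uniq.
have ulc : uniq lc by rewrite /= inE !mem_enum !inE (negbTE st) !eqxx andbF enum_uniq.
have szE : size la = size lc.
  rewrite -(card_uniqP ula) -(card_uniqP ulc); rewrite (eq_card mem_la) AC.
  by rewrite (eq_card mem_lc).
have ilt x : x \in A -> index x la < size lc by rewrite -szE index_mem mem_la.
exists (fun x => nth s lc (index x la)); split.
- move=> x y xA yA /eqP; rewrite nth_uniq ?ilt // => /eqP E.
  by rewrite -[x](@nth_index _ a x la) ?mem_la // E nth_index ?mem_la.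
- by move=> x xA; rewrite -mem_lc mem_nth ?ilt.
- by rewrite /= eqxx.
- by rewrite /= (negbTE ab) eqxx.
Qed.

Section StrongColouring.
Variables (V T : finType).
Implicit Types (e : rel V) (f : V -> V -> T).

Definition degree e x := #|[set y | e x y]|.

Definition strong_colouring e f :=
  [/\ forall x y, e x y -> f x y = f y x,
      forall x u v, e x u -> e x v -> f x u = f x v -> u = v
    & forall x y u v, e x y -> e x u -> e y v -> f x u = f y v -> u = y /\ v = x].

Definition delete_edge e (u v : V) : rel V :=
  fun x y => e x y && ((x, y) != (u, v)) && ((x, y) != (v, u)).

(** The colours forbidden for [uv] occur at [v] or at its only non-leaf neighbour [w], so there are
    at most [(deg v - 1) + (deg w - 1)] of them, fewer than [#|T|]. *)
Lemma strong_colouring_leaf e f (u v : V) : symmetric e -> irreflexive e -> e u v ->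
  degree e u = 1 ->
  (forall w w', e v w -> e v w' -> 1 < degree e w -> 1 < degree e w' -> w = w') ->
  (forall x y, e x y -> degree e x + degree e y <= #|T|.+1) ->
  degree e v <= #|T| ->
  strong_colouring (delete_edge e u v) f -> exists f', strong_colouring e f'.
Proof.
move=> sym irr uv du one deg degv [fsym finj fdist].
have uE w : e u w -> w = v.
  move=> uw; have /eqP/cards1P[z Ez] := du.
  have : w \in [set y | e u y] by rewrite inE.
  have : v \in [set y | e u y] by rewrite inE.
  by rewrite Ez !inE => /eqP-> /eqP.
have uv' : u != v by apply: contraTneq uv => ->; rewrite irr.
pose N w x := [set f w y | y in [set y | e w y] :\ x].
have cN w x : e w x -> #|N w x| < degree e w.
  move=> wx; apply: leq_ltn_trans (leq_imset_card _ _) _.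
  by rewrite /degree (cardsD1 x [set y | e w y]) inE wx.
pose F := N v u :|: \bigcup_(w | e v w && (1 < degree e w)) N w v.
have [t tF] : exists t, t \notin F.
  suff : #|F| < #|T|.
    rewrite -(cardsC F) -[X in X < _]addn0 ltn_add2l => /card_gt0P[t].
    by rewrite inE; exists t.
  have vu : e v u by rewrite sym.
  have [w /andP[vw dw]|none] := pickP (fun w => e v w && (1 < degree e w)).
    have sF : F \subset N v u :|: N w v.
      apply: setUS; apply/bigcupsP => w' /andP[vw' dw'].
      by rewrite (one w' w).
    apply: leq_ltn_trans (subset_leq_card sF) _.
    apply: leq_ltn_trans (leq_card_setU _ _) _.
    have wv : e w v by rewrite sym.
    by have := deg _ _ vw; have := cN v u vu; have := cN w v wv; clear; lia.
  rewrite /F big_pred0 // setU0; apply: leq_trans (cN v u vu) degv.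
pose f' x y := if ((x, y) == (u, v)) || ((x, y) == (v, u)) then t else f x y.
have f'uv : f' u v = t by rewrite /f' eqxx.
have f'vu : f' v u = t by rewrite /f' eqxx orbT.
have old x y : x != u -> (x, y) != (v, u) -> f' x y = f x y /\ (e x y -> delete_edge e u v x y).
  move=> xu xyvu; rewrite /f' /delete_edge (negbTE xyvu) xpair_eqE (negbTE xu) /=.
  by split=> // ->.
have oldx x y : x != u -> x != v -> f' x y = f x y /\ (e x y -> delete_edge e u v x y).
  by move=> xu xv; apply: old => //; rewrite xpair_eqE (negbTE xv).
have oldv y : y != u -> f' v y = f v y /\ (e v y -> delete_edge e u v v y).
  by move=> yu; apply: old; [rewrite eq_sym | rewrite xpair_eqE (negbTE yu) andbF].
have f'sym x y : e x y -> f' x y = f' y x.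
  move=> xy; rewrite /f' ![(x, y) == _]xpair_eqE ![(y, x) == _]xpair_eqE.
  rewrite orbC [(y == v) && _]andbC [(y == u) && _]andbC.
  case: ifP => // none; apply: fsym; rewrite /delete_edge xy !xpair_eqE.
  by rewrite -negb_or orbC none.
have tv y : e v y -> y != u -> f v y != t.
  move=> vy yu; apply: contraNneq tF => <-; rewrite inE; apply/orP; left.
  by apply/imsetP; exists y; rewrite // !inE yu.
have tw y b : e v y -> y != u -> e y b -> f' y b != t.
  move=> vy yu yb; have yv : y != v by apply: contraTneq vy => ->; rewrite irr.
  have [bv|bv] := eqVneq b v.
    by rewrite bv f'sym -?bv // bv; have [-> _] := oldv y yu; apply: tv.
  have [-> _] := oldx y b yu yv; apply: contraNneq tF => <-; rewrite inE; apply/orP; right.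
  apply/bigcupP; exists y; last by apply/imsetP; exists b; rewrite // !inE bv.
  rewrite vy; apply/card_gt1P; exists b, v; rewrite !inE yb bv /=; split=> //.
  by rewrite sym.
have f'inj x a b : e x a -> e x b -> f' x a = f' x b -> a = b.
  move=> xa xb; have [xu|xu] := eqVneq x u.
    by rewrite xu in xa xb; rewrite (uE _ xa) (uE _ xb).
  have [xv|xv] := eqVneq x v; last first.
    have [-> /(_ xa) xa'] := oldx x a xu xv; have [-> /(_ xb) xb'] := oldx x b xu xv.
    exact: finj.
  rewrite xv in xa xb *; have [au|au] := eqVneq a u; have [bu|bu] := eqVneq b u.
  - by rewrite au bu.
  - by rewrite au f'vu; have [-> _] := oldv b bu => E; have := tv b xb bu; rewrite -E eqxx.
  - by rewrite bu f'vu; have [-> _] := oldv a au => E; have := tv a xa au; rewrite E eqxx.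
  - by have [-> /(_ xa) xa'] := oldv a au; have [-> /(_ xb) xb'] := oldv b bu; apply: finj.
(* Up to exchanging [x] and [y], these are all positions of [xy] relative to [uv]. *)
have half x y a b : e x y -> e x a -> e y b -> (x == u) || (x == v) && (y != u) || (y != u) && (y != v) ->
    f' x a = f' y b -> a = y /\ b = x.
  move=> xy xa yb; have [xu|xu] /= := eqVneq x u.
    rewrite xu in xy xa *; have yv := uE _ xy; have av := uE _ xa.
    rewrite yv in yb *; rewrite av f'uv => _ E; split=> //.
    have [//|bu] := eqVneq b u.
    by have := tv b yb bu; have [<- _] := oldv b bu; rewrite -E eqxx.
  have [xv|xv] /= := eqVneq x v; last first.
    move=> /andP[yu yv]; have [-> /(_ xa) xa'] := oldx x a xu xv.
    have [-> /(_ yb) yb'] := oldx y b yu yv.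
    by apply: fdist => //; apply: (oldx x y xu xv).2.
  have yv : y != v by apply: contraTneq xy => ->; rewrite xv irr.
  rewrite yv andbT orbb => yu E.
  rewrite xv in xy xa E *; have [au|au] := eqVneq a u.
    by have := tw y b xy yu yb; rewrite -E au f'vu eqxx.
  have [E1 /(_ xa) xa'] := oldv a au; have [E2 /(_ yb) yb'] := oldx y b yu yv.
  by apply: fdist xa' yb' _; [apply: (oldv y yu).2 | rewrite -E1 -E2].
exists f'; split=> // x y a b xy xa yb E.
have [ok|] := boolP ((x == u) || (x == v) && (y != u) || (y != u) && (y != v)).
  exact: half ok E.
rewrite !negb_or !negb_and !negbK => /andP[/andP[xu xvyu] yuv].
have yx : e y x by rewrite sym.
suff [-> ->] : b = x /\ a = y by [].
apply: half (yx) yb xa _ (esym E).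
by case/orP: yuv => [->//|yv]; rewrite yv xu orbT.
Qed.

End StrongColouring.

Ltac arith :=
  repeat match goal with
  | H : ?P |- _ =>
    lazymatch type of P with
    | Prop =>
      lazymatch P with
      | is_true (leq _ _) => fail
      | is_true (leq _ _ && leq _ _) => fail
      | is_true (~~ (leq _ _ && leq _ _)) => fail
      | is_true (~~ (@eq_op _ _ _)) => fail
      | @eq nat _ _ => fail
      | @eq nat _ _ -> False => fail
      | _ => clear H
      end
    end
  end; lia.

Section Recolouring.
Variables (V T : finType) (e : rel V) (c : seq V) (x0 : V).
Let k := #|T|.
Let L := spine_size k.
Let e1 : rel V := fun x y => [&& e x y, 1 < degree e x & 1 < degree e y].
Let X j := nth x0 c j.
Hypotheses (sym_e : symmetric e) (irr_e : irreflexive e) (k4 : 4 < k)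
  (deg_edge : forall x y, e x y -> degree e x + degree e y <= k.+1)
  (deg_le : forall x y, e x y -> degree e x + 2 <= k)
  (cyc : ucycle e1 c) (long : L.+1 < size c)
  (thread : forall j, 0 < j <= L -> degree e1 (X j) = 2).

(** Off the cycle [index] returns [size c], which exceeds [L]. *)
Definition on_thread x := 0 < index x c <= L.

(** The two edges joining the thread to the rest are kept, since their colours are prescribed; the
    leaf edges at the thread and its inner edges are uncoloured. *)
Definition keep_outside_thread : rel V := fun x y => e x y &&
  (~~ on_thread x && ~~ on_thread y ||
   ((x, y) \in [:: (X 0, X 1); (X 1, X 0); (X L, X L.+1); (X L.+1, X L)])).

Let e1_sym : symmetric e1.
Proof. by move=> x y; rewrite /e1 sym_e [(1 < _) && _]andbC. Qed.

Let L6 : 6 < L.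
Proof. by rewrite /L /spine_size; case: ifP => // _; rewrite leq_max. Qed.

Let step j : j <= L -> e1 (X j) (X j.+1).
Proof.
move=> jL; case/andP: cyc => pc uc.
have jlt : j < size c by apply: leq_ltn_trans _ long; apply: leqW.
have := next_cycle pc (mem_nth x0 jlt); rewrite next_nth mem_nth //.
rewrite /X; case: c uc long jlt => [|x c'] // uc' long' jlt.
rewrite index_uniq // [nth x0 _ j.+1]/= (set_nth_default x0 x) //.
by apply: leq_ltn_trans jL _; rewrite -ltnS.
Qed.

Let XindexE j : j <= L.+1 -> index (X j) c = j.
Proof.
move=> jL; case/andP: cyc => _ uc.
by rewrite index_uniq //; apply: leq_ltn_trans jL long.
Qed.

Let onX j : j <= L.+1 -> on_thread (X j) = (0 < j <= L).
Proof. by move=> jL; rewrite /on_thread XindexE. Qed.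

Let X_inj i j : i <= L.+1 -> j <= L.+1 -> X i = X j -> i = j.
Proof. by move=> iL jL E; rewrite -(XindexE iL) E XindexE. Qed.

Let onP x : on_thread x -> exists2 j, 0 < j <= L & x = X j.
Proof.
move=> xS; exists (index x c) => //; rewrite /X nth_index //.
by rewrite -index_mem; case/andP: xS => _ /leq_ltn_trans; apply; apply: ltn_trans long.
Qed.

Let neighbours j y : 0 < j <= L -> e1 (X j) y -> y = X j.-1 \/ y = X j.+1.
Proof.
move=> /andP[j0 jL] xy.
have sub : [set X j.-1; X j.+1] \subset [set y | e1 (X j) y].
  apply/subsetP => z; rewrite !inE => /orP[]/eqP->; last exact: step.
  by rewrite e1_sym; have := @step j.-1; rewrite prednK //; apply; arith.
have ne : X j.-1 != X j.+1 by apply/eqP => /X_inj; arith.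
have : [set X j.-1; X j.+1] == [set y | e1 (X j) y].
  by rewrite eqEcard sub cards2 ne; have := thread (j := j); rewrite /degree j0 jL => ->.
by move=> /eqP/setP/(_ y); rewrite !inE xy => /orP[/eqP|/eqP]; [left | right].
Qed.

Let outside x y : ~~ on_thread x -> 1 < degree e x -> e x y ->
  on_thread y -> (x = X 0 /\ y = X 1) \/ (x = X L.+1 /\ y = X L).
Proof.
move=> xS dx xy /onP[j jL yj].
have e1yx : e1 (X j) x.
  case/andP: jL => j0 jL; have /and3P[_ dX _] := step jL.
  by rewrite /e1 dX dx -yj sym_e xy.
case: (neighbours jL e1yx) => E; rewrite E onX in xS; try arith.
  have j1 : j = 1 by arith.
  by left; rewrite yj E j1.
have jL' : j = L by arith.
by right; rewrite yj E jL'.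
Qed.

Let kept x y : ~~ on_thread x -> 1 < degree e x -> e x y -> keep_outside_thread x y.
Proof.
move=> xS dx xy; rewrite /keep_outside_thread xy /= xS /=.
have [yS|//] := boolP (on_thread y); rewrite !inE !xpair_eqE /=.
by case: (outside xS dx xy yS) => -[-> ->]; rewrite !eqxx ?orbT.
Qed.

Lemma keep_outside_thread_sym : symmetric keep_outside_thread.
Proof.
move=> x y; rewrite /keep_outside_thread sym_e [~~ on_thread x && _]andbC !inE !xpair_eqE.
congr (_ && (_ || _)); rewrite ![(y == _) && _]andbC.
case: ((x == X 0) && (y == X 1)); case: ((x == X 1) && (y == X 0)) => //=.
exact: orbC.
Qed.

Lemma keep_outside_thread_proper : exists x y, e x y && ~~ keep_outside_thread x y.
Proof.
have L12 : 1 <= L by arith.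
exists (X 1), (X 2); have /and3P[-> _ _] := step L12.
rewrite /keep_outside_thread (onX (leqW L12)) L12 /=.
apply/negP => /andP[_]; apply/negP; rewrite !inE !xpair_eqE !negb_or !negb_and.
have ne i j : i <= L.+1 -> j <= L.+1 -> i != j -> X i != X j.
  by move=> iL jL; apply: contraNneq => /X_inj->.
by rewrite (ne 1 0) ?(ne 2 0) ?(ne 2 L.+1) ?(ne 1 L.+1) ?orbT //; arith.
Qed.

Lemma recolour_thread (f : V -> V -> T) : strong_colouring keep_outside_thread f ->
  exists f' : V -> V -> T, strong_colouring e f'.
Proof.
move=> [fsym finj fdist].
have end0 : ~~ on_thread (X 0) by rewrite onX.
have endL : ~~ on_thread (X L.+1) by rewrite onX // ltnn andbF.
have d0 : 1 < degree e (X 0) by case/and3P: (step (leq0n L)).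
have dL : 1 < degree e (X L.+1) by case/and3P: (step (leqnn L)).
have eX j : j <= L -> e (X j) (X j.+1) by move/step/and3P=> [].
pose C0 := [set f (X 0) y | y in [set y | e (X 0) y]].
pose CL := [set f (X L.+1) y | y in [set y | e (X L.+1) y]].
have cC0 : #|C0| = degree e (X 0).
  by apply: card_in_imset => y z; rewrite !inE => /(kept end0 d0) ? /(kept end0 d0) ?; apply: finj.
have cCL : #|CL| = degree e (X L.+1).
  by apply: card_in_imset => y z; rewrite !inE => /(kept endL dL) ? /(kept endL dL) ?; apply: finj.
pose c0 := f (X 0) (X 1); pose cL := f (X L.+1) (X L).
have c0in : c0 \in C0 by apply: imset_f; rewrite inE eX.
have cLin : cL \in CL by apply: imset_f; rewrite inE sym_e eX.
have around (C : {set T}) z d : z \in C -> 0 < d -> #|C| + d <= k.+1 ->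
    exists D : {set T}, [/\ z \in D, #|D| = d & C :&: D = [set z]].
  move=> zC d0' le.
  have [||D [zD sD cD]] := @subset_between _ [set z] (z |: ~: C) d.
  - by rewrite sub1set setU11.
  - rewrite cards1 d0' cardsU1 inE zC /=; have := cardsC C; rewrite -/k; arith.
  exists D; split=> //; first by rewrite -sub1set.
  apply/setP => w; rewrite !inE; apply/andP/eqP => [[wC /(subsetP sD)]|->].
    by rewrite !inE wC orbF => /eqP.
  by rewrite zC -sub1set.
(* The sets at [X 1] and [X L] are chosen against the fixed sets of their outer neighbours;
   [spine_extend] fills in those between. *)
have [C1 [c0C1 cC1 C01]] : exists D : {set T}, [/\ c0 \in D, #|D| = degree e (X 1) & C0 :&: D = [set c0]].
  apply: around => //; first by have /and3P[_ _ /ltnW] := step (leq0n L).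
  by rewrite cC0; apply: deg_edge; apply: eX.
have [C' [cLC' cC' CL']] : exists D : {set T}, [/\ cL \in D, #|D| = degree e (X L) & CL :&: D = [set cL]].
  apply: around => //; first by have /and3P[_ /ltnW] := step (leqnn L).
  by rewrite cCL addnC; apply: deg_edge; apply: eX.
pose ds := [seq degree e (X j.+2) | j <- iota 0 L.-1].
have nth_ds j : j < L.-1 -> nth 0 ds j = degree e (X j.+2).
  by move=> jL; rewrite (nth_map 0) ?size_iota // nth_iota.
have szds : size ds = L.-1 by rewrite size_map size_iota.
have all_ds : all (spine_degree k) (degree e (X 1) :: ds).
  have deg2 j : j <= L -> spine_degree k (degree e (X j)).
    move=> jL; have /and3P[xy dx _] := step jL; rewrite /spine_degree dx.
    by have := deg_le xy; rewrite addn2.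
  rewrite /= deg2 ?(leq_trans _ L6) //; apply/allP => d /mapP[j]; rewrite mem_iota => jL ->.
  by apply: deg2; arith.
have path_ds : path (spine_edge k) (degree e (X 1)) ds.
  apply/(pathP 0) => j; rewrite szds => jL.
  have -> : nth 0 (degree e (X 1) :: ds) j = degree e (X j.+1).
    by case: j jL => // j jL; rewrite [LHS]nth_ds //; arith.
  by rewrite nth_ds // /spine_edge; apply: deg_edge; apply: eX; arith.
have last_ds : #|C'| = last (degree e (X 1)) ds.
  have lt : L.-1.-1 < L.-1 by arith.
  rewrite cC' -nth_last szds (set_nth_default 0) ?szds // nth_ds //.
  by congr (degree e (X _)); arith.
have := @spine_extend T k k4 setT C1 C' c0 cL _ _ (cardsT T) (subsetT _) (subsetT _) szds all_ds path_ds cC1 last_ds.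
move=> /spine_ext_seq[D [o]]; rewrite szds => -[[D0 Dn] [o0 on] cards meets neq].
rewrite prednK in on; last by arith.
(* From here on [Cs j] is the colour set of [X j], outer neighbours included, and [o j] the colour
   of the edge from [X j] to [X j.+1]. *)
pose Cs j := if j is j'.+1 then (if j == L.+1 then CL else D j') else C0.
have CsE j : 0 < j <= L -> Cs j = D j.-1.
  by case: j => // j jL; rewrite /Cs ifN //; arith.
have cCs j : 0 < j <= L -> #|Cs j| = degree e (X j).
  move=> jL; rewrite CsE //; case: j jL => [//|[|j]] jL /=; first by rewrite D0.
  by rewrite cards ?nth_ds //; arith.
have CsI j : j <= L -> Cs j :&: Cs j.+1 = [set o j].
  case: j => [|j] jL.
    by rewrite (CsE 1) ?D0 ?o0 // (leq_trans _ L6).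
  rewrite CsE //; have [jE|jN] := eqVneq j.+1 L.
    by rewrite /Cs jE eqxx setIC Dn CL' on.
  by rewrite CsE ?[_.-1]/= ?meets //; arith.
have oD j : j <= L -> o j \in Cs j /\ o j \in Cs j.+1.
  by move=> jL; have := set11 (o j); rewrite -CsI // inE => /andP.
have hex (j : 'I_L.+2) : exists g : V -> T, 0 < j <= L ->
    [/\ {in [set y | e (X j) y] &, injective g}, {in [set y | e (X j) y], forall y, g y \in Cs j},
        g (X j.-1) = o j.-1 & g (X j.+1) = o j].
  have [jL|_] := boolP (0 < j <= L); last first.
    by exists (fun=> c0).
  have [j0 jL'] := andP jL.
  have pj : j.-1 <= L := leq_trans (leq_pred _) jL'.
  have := oD _ pj; have := oD _ jL'; rewrite prednK // => -[oj _] [_ opj].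
  have [|||||||g gP] := @inject_two_points V T [set y | e (X j) y] (Cs j) (X j.-1) (X j.+1) (o j.-1) (o j).
  - by rewrite cCs.
  - by rewrite inE sym_e; have := eX _ pj; rewrite prednK.
  - by rewrite inE eX.
  - by apply/eqP => /X_inj; arith.
  - exact: opj.
  - exact: oj.
  - by have := neq j.-1; rewrite prednK //; apply; arith.
  by exists g.
have [h hP] := fin_all_exists hex.
pose hx x := h (inord (index x c)).
have hxE j : j <= L.+1 -> hx (X j) = h (inord j) by move=> jL; rewrite /hx XindexE.
have inordE j : j <= L.+1 -> (inord j : 'I_L.+2) = j :> nat by move=> jL; rewrite inordK.
have hX j : 0 < j <= L ->
    [/\ {in [set y | e (X j) y] &, injective (hx (X j))}, {in [set y | e (X j) y], forall y, hx (X j) y \in Cs j},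
        hx (X j) (X j.-1) = o j.-1 & hx (X j) (X j.+1) = o j].
  move=> jL; have jL1 : j <= L.+1 by arith.
  by have := hP (inord j); rewrite inordE // hxE //; apply.
pose f' x y := if on_thread x then hx x y else if on_thread y then hx y x else f x y.
have f'X j y : 0 < j <= L -> f' (X j) y = hx (X j) y by move=> jL; rewrite /f' onX ?jL //; arith.
have L1 : 0 < 1 <= L by arith.
have LL : 0 < L <= L by arith.
have f'out x y : ~~ on_thread x -> 1 < degree e x -> e x y -> f' x y = f x y.
  move=> xS dx xy; rewrite /f' (negbTE xS); case: ifP => // yS.
  case: (outside xS dx xy yS) => -[-> ->].
    by have [_ _ + _] := hX 1 L1 => /= ->.
  by have [_ _ _ ->] := hX L LL.
have f'pair j : j <= L -> f' (X j) (X j.+1) = o j.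
  case: j => [_|j jL]; first by rewrite f'out ?eX // -o0.
  by rewrite f'X //; have [_ _ _ ->] := hX j.+1 jL.
have f'sym x y : e x y -> f' x y = f' y x.
  move=> xy; rewrite {2}/f'; have [yS|yS] := boolP (on_thread y); last first.
    rewrite /f' (negbTE yS); have [//|xS] := boolP (on_thread x).
    by apply: fsym; rewrite /keep_outside_thread xy xS yS.
  rewrite /f' yS; have [xS|//] := boolP (on_thread x).
  have [i iL xi] := onP xS; have [j jL yj] := onP yS.
  have e1xy : e1 (X i) y.
    rewrite /e1 -xi xy /=; have /andP[_ iL'] := iL; have /andP[_ jL'] := jL.
    by rewrite xi yj; case/and3P: (step iL') => _ -> _; case/and3P: (step jL').
  have [_ _ hi1 hi2] := hX i iL; have [_ _ hj1 hj2] := hX j jL.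
  rewrite xi; case: (neighbours iL e1xy) => yE; rewrite yj in yE *.
    have jE : j = i.-1 by apply: X_inj yE; arith.
    rewrite jE in hj2 *; rewrite hi1; move: hj2; rewrite prednK; last by arith.
    by move->.
  have jE : j = i.+1 by apply: X_inj yE; arith.
  by rewrite jE in hj1 *; rewrite hi2 hj1.
have leafE x u v : ~~ (1 < degree e x) -> e x u -> e x v -> u = v.
  move=> dx xu xv; apply/eqP; apply: contraR dx => ne.
  by apply/card_gt1P; exists u, v; rewrite !inE.
have f'inj x u v : e x u -> e x v -> f' x u = f' x v -> u = v.
  move=> xu xv; have [dx|/leafE] := boolP (1 < degree e x); last by move/(_ u v xu xv).
  have [/onP[j jL xj]|xS] := boolP (on_thread x); last first.
    by rewrite !f'out //; apply: finj; apply: kept.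
  rewrite xj in xu xv *; rewrite !f'X //; have [inj _ _ _] := hX j jL.
  by apply: inj; rewrite inE.
have f'in j y : j <= L.+1 -> e (X j) y -> f' (X j) y \in Cs j.
  case: j => [_|j]; first by move=> xy; rewrite f'out //; apply: imset_f; rewrite inE.
  rewrite leq_eqVlt => /orP[/eqP[->]|jL] xy.
    by rewrite f'out // /Cs eqxx; apply: imset_f; rewrite inE.
  rewrite f'X //; have [_ inC _ _] := hX j.+1 jL.
  by apply: inC; rewrite inE.
have pair j u v : j <= L -> e (X j) u -> e (X j.+1) v -> f' (X j) u = f' (X j.+1) v ->
    u = X j.+1 /\ v = X j.
  move=> jL xu yv E.
  have : f' (X j) u \in Cs j :&: Cs j.+1 by rewrite inE f'in ?(leqW jL) // E f'in.
  rewrite CsI // inE => /eqP uo; split.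
    by apply: f'inj xu (eX j jL) _; rewrite uo f'pair.
  have yx : e (X j.+1) (X j) by rewrite sym_e eX.
  by apply: f'inj yv yx _; rewrite -E uo -f'pair // f'sym ?eX.
have pair' j y u v : 0 < j <= L -> e1 (X j) y -> e (X j) u -> e y v -> f' (X j) u = f' y v ->
    u = y /\ v = X j.
  move=> jL xy xu; case: (neighbours jL xy) => -> yv E; last first.
    by apply: pair => //; case/andP: jL.
  have j1 : j.-1.+1 = j by rewrite prednK //; case/andP: jL.
  by have := pair j.-1 v u; rewrite j1 => -[] //; arith.
exists f'; split=> // x y u v xy xu yv E.
have yx : e y x by rewrite sym_e.
(* The only edge at a leaf is [xy] itself, so the condition reduces to injectivity at the other
   end. *)
have [dx|dx] := boolP (1 < degree e x); last first.
  have uy := leafE _ _ _ dx xu xy; split=> //.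
  by apply: f'inj yv yx _; rewrite -E uy f'sym.
have [dy|dy] := boolP (1 < degree e y); last first.
  have vx := leafE _ _ _ dy yv yx; split=> //.
  by apply: f'inj xu xy _; rewrite E vx f'sym.
have [/onP[j jL xj]|xS] := boolP (on_thread x).
  rewrite xj in xy xu dx E *; apply: pair' => //.
  by rewrite /e1 xy dx.
have [/onP[j jL yj]|yS] := boolP (on_thread y).
  rewrite yj in xy yx yv dy E *.
  suff [-> ->] : v = x /\ u = X j by [].
  by apply: pair' => //; rewrite /e1 yx dx dy.
rewrite !f'out // in E.
by apply: fdist E; apply: kept.
Qed.

End Recolouring.

(** * The induction over subgraphs *)

Lemma degree_sub (V : finType) (e e' : rel V) x : subrel e' e -> degree e' x <= degree e x.
Proof. by move=> sub; apply/subset_leq_card/subsetP => y; rewrite !inE; apply: sub. Qed.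

Lemma sub_ucycle (V : finType) (e e' : rel V) c : subrel e' e -> ucycle e' c -> ucycle e c.
Proof. by move=> sub /andP[pc uc]; rewrite /ucycle uc andbT; apply: sub_cycle pc. Qed.

(** Planarity enters through the last hypothesis, which ranges over all subgraphs so that it is
    inherited along the induction. *)
Lemma strong_colouring_exists (V T : finType) (e : rel V) :
  symmetric e -> irreflexive e -> 4 < #|T| ->
  (forall x y, e x y -> degree e x + degree e y <= #|T|.+1) ->
  (forall x y, e x y -> degree e x + 2 <= #|T|) ->
  (forall c, ucycle e c -> 2 < size c -> 5 * spine_size #|T| < size c) ->
  (forall e' : rel V, symmetric e' -> subrel e' e -> (exists x y, e' x y) -> has_faces e') ->
  exists f : V -> V -> T, strong_colouring e f.
Proof.
move=> + + k4; have [m] := ubnP #|[set p : V * V | e p.1 p.2]|.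
elim: m e => // m IH e lem sym irr deg_edge deg_le girth faces.
have down e' : symmetric e' -> subrel e' e -> (exists x y, e x y && ~~ e' x y) ->
    exists f : V -> V -> T, strong_colouring e' f.
  move=> sym' sub [x [y /andP[xy xy']]]; apply: IH => //.
  - rewrite ltnS in lem; apply: leq_trans lem; apply: proper_card; apply/properP; split.
      by apply/subsetP => p; rewrite !inE; apply: sub.
    by exists (x, y); rewrite inE.
  - by move=> z; apply: contraFF (irr z); apply: sub.
  - by move=> u v /sub/deg_edge; apply: leq_trans; apply: leq_add; apply: degree_sub.
  - by move=> u v /sub/deg_le; apply: leq_trans; rewrite leq_add2r degree_sub.
  - by move=> c /(sub_ucycle sub); apply: girth.
  by move=> e2 sym2 sub2; apply: faces => // u v /sub2/sub.
have [/existsP[x /existsP[y xy]]|noedge] := boolP [exists x, exists y, e x y]; last first.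
  have [t _] : exists t, t \in T by apply/card_gt0P; apply: leq_trans k4.
  have no x y : ~~ e x y by apply: contra noedge => xy; apply/existsP; exists x; apply/existsP; exists y.
  by exists (fun _ _ => t); split=> [a b h|a b z h|a b z w h]; move: h; rewrite (negbTE (no _ _)).
pose removable u v := [&& e u v, degree e u == 1 &
  [forall w, forall w', [&& e v w, e v w', 1 < degree e w & 1 < degree e w'] ==> (w == w')]].
have [/existsP[u /existsP[v /and3P[uv /eqP du one]]]|core] := boolP [exists u, exists v, removable u v].
  have [|||f fP] := down (delete_edge e u v).
  - move=> z w; rewrite /delete_edge sym !xpair_eqE -!andbA [(w == u) && _]andbC [(w == v) && _]andbC.
    by rewrite [X in _ && X]andbC.
  - by move=> z w /andP[/andP[]].
  - by exists u, v; rewrite /delete_edge uv eqxx andbF.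
  apply: (strong_colouring_leaf sym irr uv du _ deg_edge _ fP).
    move=> w w' vw vw' dw dw'; apply/eqP; move: one => /forallP/(_ w)/forallP/(_ w')/implyP; apply.
    by rewrite vw vw' dw.
  by rewrite sym in uv; apply: leq_trans (deg_le _ _ uv); apply: leq_addr.
pose e1 : rel V := fun x y => [&& e x y, 1 < degree e x & 1 < degree e y].
have sym1 : symmetric e1 by move=> u v; rewrite /e1 sym [(1 < _) && _]andbC.
have sub1 : subrel e1 e by move=> u v /and3P[].
have deg1 u v : e u v -> 0 < degree e u by move=> uv; apply/card_gt0P; exists v; rewrite inE.
have two u v : e u v -> degree e u = 1 ->
    exists w w', [/\ w != w', e v w, e v w', 1 < degree e w & 1 < degree e w'].
  move=> uv du; move/existsPn/(_ u)/existsPn/(_ v): core; rewrite /removable uv du eqxx /=.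
  move=> /forallPn[w /forallPn[w']]; rewrite negb_imply => /andP[/and4P[vw vw' dw dw'] ww'].
  by exists w, w'.
(* A leaf at [u] that is not removable exhibits two non-leaf neighbours of [u]; without leaves, [u]
   keeps all its neighbours. *)
have min1 u : 1 < degree e u -> 1 < degree e1 u.
  move=> du; have [/existsP[v /andP[uv /eqP dv]]|noleaf] := boolP [exists v, e u v && (degree e v == 1)].
    have [w [w' [ww' uw uw' dw dw']]] := two v u (etrans (sym v u) uv) dv.
    by apply/card_gt1P; exists w, w'; rewrite !inE /e1 uw uw' du dw dw'.
  apply: (leq_trans du); apply/subset_leq_card/subsetP => v; rewrite !inE => uv.
  have dv : degree e v != 1.
    by apply: contra noleaf => dv; apply/existsP; exists v; rewrite uv.
  by rewrite /e1 uv du ltn_neqAle eq_sym dv (deg1 v u) // sym.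
have min_degree u v : e1 u v -> 1 < degree e1 u by move=> /and3P[_ du _]; apply: min1.
have nonempty1 : exists u v, e1 u v.
  have [dx|dx] := boolP (1 < degree e x).
    by have /ltnW/card_gt0P[z] := min1 x dx; rewrite inE; exists x, z.
  have dx1 : degree e x = 1 by have := deg1 x y xy; move: dx; clear; lia.
  have [w [w' [ww' yw yw' dw dw']]] := two x y xy dx1.
  exists y, w; rewrite /e1 yw dw andbT /=.
  by apply/card_gt1P; exists w, w'; rewrite !inE yw yw' ww'.
have irr1 : irreflexive e1 by move=> u; rewrite /e1 irr.
have L0 : 0 < spine_size #|T| by rewrite /spine_size; case: ifP => // _; rewrite leq_max.
have [|c [x0 [cyc long thread]]] :=
    long_thread irr1 (faces e1 sym1 sub1 nonempty1) min_degree nonempty1 L0.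
  by move=> c /(sub_ucycle sub1); apply: girth.
have long1 : (spine_size #|T|).+1 < size c.
  by apply: leq_ltn_trans long; move: L0; clear; lia.
have [|||f fP] := down (keep_outside_thread T e c x0).
- exact: keep_outside_thread_sym.
- by move=> u v /andP[].
- exact: keep_outside_thread_proper.
exact: recolour_thread fP.
Qed.

(** * Strong colourings and the strong chromatic index *)

Section Index.
Variable G : sgraph.

Lemma edge_at (A : edge G) x : x \in val A -> exists2 u, x -- u & val A = [set x; u].
Proof.
have := valP A; rewrite inE => /existsP[a /existsP[b /andP[ab /eqP ->]]].
rewrite !inE => /orP[]/eqP->; first by exists b.
by exists a; rewrite 1?adj_sym // setUC.
Qed.

Lemma set2_inj (x u v : G) : x -- u -> [set x; u] = [set x; v] -> u = v.
Proof.
move=> xu /setP/(_ u); rewrite !inE eqxx orbT => /esym/orP[]/eqP // ux.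
by rewrite ux adj_irr in xu.
Qed.

Lemma strongly_colorable_of k (f : G -> G -> 'I_k) (t : 'I_k) :
  strong_colouring (@adj G) f -> strongly_colorable G k.
Proof.
move=> [fsym finj fdist].
pose c : {ffun edge G -> 'I_k} := [ffun A : edge G =>
  if [pick p : G * G | (p.1 -- p.2) && (val A == [set p.1; p.2])] is Some p then f p.1 p.2 else t].
have cE (A : edge G) x y : x -- y -> val A = [set x; y] -> c A = f x y.
  move=> xy AE; rewrite ffunE; case: pickP => [[a b] /= /andP[ab /eqP E]|/(_ (x, y))]; last first.
    by rewrite /= xy AE eqxx.
  rewrite AE in E; have : x \in [set a; b] by rewrite -E setU11.
  rewrite !inE => /orP[]/eqP xE; rewrite xE in xy E *.
    by rewrite (set2_inj xy E).
  have E' : [set b; y] = [set b; a] by rewrite E setUC.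
  by rewrite (set2_inj xy E') fsym.
apply/existsP; exists c; apply/forallP => A; apply/forallP => B; apply/implyP => /andP[AB near].
apply: contraNneq AB => E; apply/eqP/val_inj.
case/orP: near => [/exists_inP[x xA xB]|/exists_inP[x xA /exists_inP[y yB xy]]].
  have [u xu AE] := edge_at xA; have [v xv BE] := edge_at xB.
  by rewrite AE BE (finj x u v) // -(cE A) // -(cE B).
have [u xu AE] := edge_at xA; have [v yv BE] := edge_at yB.
have [|uy vx] := fdist x y u v xy xu yv; first by rewrite -(cE A) // -(cE B).
by rewrite AE BE uy vx setUC.
Qed.

(** The [deg x + deg y - 1] edges at the ends of an edge [xy] are pairwise within distance two. *)
Lemma sigma_le k : strongly_colorable G k -> sigma G <= k.
Proof.
move=> /existsP[c /forallP cP]; apply/bigmax_leqP => -[x y] /= xy.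
pose E (z : G) := [set A : edge G | z \in val A].
pose F (z : G) := [set [set z; u] | u in [set u | z -- u]].
have cF z : #|F z| = deg z.
  by apply: card_in_imset => u v; rewrite !inE => zu _; apply: set2_inj.
have sFE : F x :|: F y \subset val @: (E x :|: E y).
  have sub z : F z \subset val @: E z.
    apply/subsetP => _ /imsetP[u zu ->]; rewrite inE in zu.
    have zuE : [set z; u] \in edges G.
      by rewrite inE; apply/existsP; exists z; apply/existsP; exists u; rewrite zu eqxx.
    pose A : edge G := exist (fun A => A \in edges G) _ zuE.
    by apply/imsetP; exists A; rewrite // inE /= setU11.
  by rewrite imsetU setUSS.
have cE : #|E x :|: E y| <= k.
  rewrite -[leqRHS]card_ord -(card_in_imset (f := c)) ?max_card // => A B AE BE cAB.
  apply/eqP; apply: contraT => AB; have := forallP (cP A) B; rewrite AB cAB eqxx implybF /= => /negP[].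
  move: AE BE; rewrite !inE /within_distance2 => /orP[]zA /orP[]wB; apply/orP.
  - by left; apply/exists_inP; exists x.
  - by right; apply/exists_inP; exists x => //; apply/exists_inP; exists y.
  - by right; apply/exists_inP; exists y => //; apply/exists_inP; exists x; rewrite // adj_sym.
  - by left; apply/exists_inP; exists y.
apply: leq_trans cE; rewrite -(card_imset _ val_inj).
apply: leq_trans (subset_leq_card sFE); rewrite cardsU !cF; apply: leq_sub2l.
apply: leq_trans (_ : #|[set [set x; y]]| <= 1); last by rewrite cards1.
apply/subset_leq_card/subsetP => A; case/setIP => /imsetP[u xu ->] /imsetP[v yv E'].
rewrite inE; apply/eqP; rewrite !inE in xu yv.
have : y \in [set x; u] by rewrite E' setU11.
by rewrite !inE => /orP[/eqP yx|/eqP<- //]; rewrite yx adj_irr in xy.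
Qed.

Lemma strong_chromatic_index_sigma :
  strongly_colorable G (sigma G) -> strong_chromatic_index G = sigma G.
Proof.
rewrite /strong_chromatic_index; case: ex_minnP => m mc min sc.
by apply/eqP; rewrite eqn_leq min // sigma_le.
Qed.

Lemma deg_sigma x y : x -- y -> degree (@adj G) x + degree (@adj G) y <= (sigma G).+1.
Proof.
move=> xy; have := @leq_bigmax_cond _ (fun p : G * G => p.1 -- p.2) (fun p => deg p.1 + deg p.2 - 1) (x, y) xy.
by rewrite /= -/(sigma G) /degree /deg; lia.
Qed.

Lemma deg_le_max x : degree (@adj G) x <= max_deg G.
Proof. exact: (@leq_bigmax _ (@deg G)). Qed.

End Index.

Lemma girth_bound_spine s : 4 < s -> girth_bound s = (5 * spine_size s).+1.
Proof.
case: s => [|[|[|[|[|[|[|[|s]]]]]]]] // _; rewrite /girth_bound /spine_size addn1 (_ : maxn 7 _ = s.+4.+4) //.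
Qed.

From HB Require Import structures.
From mathcomp Require Import all_boot all_order all_algebra.
From mathcomp Require Import all_classical all_reals all_analysis.
From mathcomp Require Import lra.

Import numFieldNormedType.Exports Order.TTheory GRing.Theory Num.Theory.

(** * Compactness of arcs in the plane *)

Section Analysis.
Local Open Scope classical_set_scope.
Local Open Scope ring_scope.
Variable R : realType.

(** The image of [K] is closed and misses 0, hence misses a ball around 0. *)
Lemma compact_lower_bound (X : topologicalType) (K : set X) (h : X -> R) :
  compact K -> continuous h -> (forall x, K x -> 0 < h x) ->
  exists2 e : R, 0 < e & forall x, K x -> e <= h x.
Proof.
move=> cK ch hpos.
have cl : closed (h @` K).
  by apply: compact_closed; [exact: Rhausdorff | apply: continuous_compact => //; apply: continuous_subspaceT].
have op : open (~` (h @` K)) by apply: closed_openC.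
have n0 : (~` (h @` K)) 0 by move=> [x Kx h0]; have := hpos x Kx; rewrite h0 ltxx.
have /nbhs_ballP[e /= e0 be] := open_nbhs_nbhs (conj op n0).
exists e => // x Kx; rewrite leNgt; apply/negP => hxe.
by apply: (be (h x)); [rewrite /ball /= sub0r normrN gtr0_norm ?hpos | exists x].
Qed.

(* Extends arcs parametrized by [0, 1] to continuous functions on the whole line. *)
Definition clamp (t : R) : R := Num.max 0 (Num.min t 1).

Lemma clamp_itv t : 0 <= clamp t <= 1.
Proof. by rewrite /clamp le_max lexx /= ge_max ler01 ge_min lexx orbT. Qed.

Lemma clamp_id t : 0 <= t <= 1 -> clamp t = t.
Proof. by case/andP=> t0 t1; rewrite /clamp min_l // max_r. Qed.

Lemma clamp_continuous : continuous clamp.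
Proof.
move=> t; apply: (@continuous_max R R^o (fun=> 0) (fun t => Num.min t 1)); first exact: cvg_cst.
by apply: (@continuous_min R R^o id (fun=> 1)); [exact: cvg_id | exact: cvg_cst].
Qed.

Lemma comp_clamp_continuous (U : topologicalType) (f : R -> U) :
  {within `[0, 1], continuous f} -> continuous (f \o clamp).
Proof.
move=> cf t.
have in01 u : `[0, 1]%classic (clamp u) by rewrite /= in_itv /= clamp_itv.
move/subspace_continuousP: cf => /(_ _ (in01 t)) cft V /cft fV.
have /= near_t := clamp_continuous fV.
exact: (filterS (fun u Hu => Hu (in01 u)) near_t).
Qed.

End Analysis.

Section Drawing.
Local Open Scope classical_set_scope.
Local Open Scope ring_scope.
Variable R : realType.

Lemma finite_common_bound (I : finType) (P : I -> R -> Prop) :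
  (forall i e e', P i e -> 0 < e' -> e' <= e -> P i e') ->
  (forall i, exists2 e, 0 < e & P i e) -> exists2 e, 0 < e & forall i, P i e.
Proof.
move=> mono ex.
suff [e e0 he] : exists2 e, 0 < e & forall i, i \in enum I -> P i e.
  by exists e => // i; apply: he; rewrite mem_enum.
elim: (enum I) => [|i s [e e0 he]]; first by exists 1.
have [e1 e10 he1] := ex i.
exists (Num.min e e1); first by rewrite lt_min e0.
move=> j; rewrite inE => /orP[/eqP ->|js].
  by apply: mono he1 _ _; rewrite ?lt_min ?e0 // ge_min lexx orbT.
by apply: mono (he j js) _ _; rewrite ?lt_min ?e0 // ge_min lexx.
Qed.

(** Both halves contain the midpoint, where the two pixel sets of an arc meet. *)
Definition half (b : bool) (t : R) : bool := if b then 2^-1 <= t <= 1 else 0 <= t <= 2^-1.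

Lemma half_itv b t : half b t -> 0 <= t <= 1.
Proof. by case: b => /= /andP[h1 h2]; apply/andP; split; lra. Qed.

Lemma half_between b s t u : half b s -> half b u -> s <= t <= u -> half b t.
Proof. by case: b => /= /andP[h1 h2] /andP[h3 h4] /andP[h5 h6]; apply/andP; split; lra. Qed.

Lemma compact_half b : compact [set t | half b t].
Proof.
by case: b => /=; [have := @segment_compact R 2^-1 1 | have := @segment_compact R 0 2^-1];
  congr compact; apply/seteqP; split=> t; rewrite /= in_itv.
Qed.

Lemma halves_separated (f g : R -> R * R) b b' : continuous f -> continuous g ->
  (forall s t, half b s -> half b' t -> f s != g t) ->
  exists2 e, 0 < e & forall s t, half b s -> half b' t -> e <= `|f s - g t|.
Proof.
move=> cf cg neq.
have [] := @compact_lower_bound R _ ([set s | half b s] `*` [set t | half b' t])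
  (fun st => `|f st.1 - g st.2|).
- by apply: compact_setX; apply: compact_half.
- move=> st; apply: cvg_norm; apply: cvgB.
    by apply: (cvg_comp _ _ (@cvg_fst _ _ _ _ _)); apply: cf.
  by apply: (cvg_comp _ _ (@cvg_snd _ _ _ _ _)); apply: cg.
- by move=> [s t] [/= hs ht]; rewrite normr_gt0 subr_eq0 neq.
by move=> e e0 he; exists e => // s t hs ht; apply: (he (s, t)).
Qed.

(** On the compact set of pairs whose images are at distance at least [m], the distance of [s] and
    [t] is positive, hence bounded below. *)
Lemma uniformly_continuous01 (f : R -> R * R) (m : R) : continuous f -> 0 < m ->
  exists2 d, 0 < d & forall s t, 0 <= s <= 1 -> 0 <= t <= 1 -> `|s - t| < d -> `|f s - f t| < m.
Proof.
move=> cf m0.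
have cn : continuous (fun st : R * R => `|f st.1 - f st.2|).
  move=> st; apply: cvg_norm; apply: cvgB.
    by apply: (cvg_comp _ _ (@cvg_fst _ _ _ _ _)); apply: cf.
  by apply: (cvg_comp _ _ (@cvg_snd _ _ _ _ _)); apply: cf.
have [] := @compact_lower_bound R _
  ((`[0, 1] `*` `[0, 1]) `&` [set st : R * R | m <= `|f st.1 - f st.2|]) (fun st => `|st.1 - st.2|).
- apply: compact_closedI; first by apply: compact_setX; apply: segment_compact.
  exact: (@closed_comp _ _ _ [set x | m <= x] (fun st _ => cn st) (@closed_ge _ m)).
- by move=> st; apply: cvg_norm; apply: cvgB; [exact: cvg_fst | exact: cvg_snd].
- move=> [s t] [_ /= h]; rewrite normr_gt0 subr_eq0; apply/eqP => st.
  by move: h; rewrite st subrr normr0 leNgt m0.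
move=> d d0 hd; exists d => // s t hs ht lt; rewrite ltNge; apply/negP => ge.
by move: lt; rewrite ltNge (hd (s, t)) //=; split=> //; split; rewrite /= in_itv.
Qed.

Lemma bounded01 (f : R -> R * R) : continuous f ->
  exists2 M, 0 < M & forall t, 0 <= t <= 1 -> `|f t| <= M.
Proof.
move=> cf.
have : compact (f @` `[0, 1]).
  by apply: continuous_compact; [exact: continuous_subspaceT | exact: segment_compact].
move=> /compact_bounded[M [_ hM]]; exists (`|M| + 1); first by rewrite ltr_wpDl.
move=> t t01; apply: hM; first by rewrite (le_lt_trans (ler_norm M)) // ltrDl.
by exists t => //=; rewrite in_itv.
Qed.

End Drawing.

(** * Pixels of a fine grid along an arc *)

Section Cells.
Local Open Scope ring_scope.
Variables (R : realType) (M mu : R).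
Hypotheses (mu0 : 0 < mu).

Definition cell (x : R) : nat := Num.truncn ((x + M) / mu).

Lemma cell_itv x : - M <= x -> mu * (cell x)%:R - M <= x < mu * (cell x)%:R + mu - M.
Proof.
move=> xM; have /truncn_itv/andP[] : 0 <= (x + M) / mu by apply: divr_ge0; [lra | exact: ltW].
rewrite -/(cell x) ler_pdivlMr // ltr_pdivrMr // -natr1 mulrDl mul1r mulrC => h1 h2.
by apply/andP; split; lra.
Qed.

Lemma cell_close x y : - M <= x -> - M <= y -> `|x - y| < mu -> (cell x <= (cell y).+1)%N.
Proof.
move=> /cell_itv/andP[x1 x2] /cell_itv/andP[y1 y2]; rewrite ltr_norml => /andP[h1 h2].
have : (cell x)%:R < (cell y)%:R + 2 :> R by rewrite -(ltr_pM2l mu0) mulrDr; lra.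
by rewrite -natrD ltr_nat addn2.
Qed.

Lemma cell_le x : - M <= x <= M -> (cell x <= Num.truncn ((M + M) / mu))%N.
Proof.
by move=> /andP[x1 x2]; apply: le_truncn; rewrite ler_pM2r ?invr_gt0 // lerD2r.
Qed.

Let n := Num.truncn ((M + M) / mu).

Definition pixel (z : R * R) : grid n := (inord (cell z.1), inord (cell z.2)).
Definition corner (p : grid n) : R * R := (mu * p.1%:R - M, mu * p.2%:R - M).

Lemma prod_norm_le (z : R * R) e : (`|z| <= e) = (`|z.1| <= e) && (`|z.2| <= e).
Proof. by rewrite prod_normE ge_max. Qed.

Lemma prod_norm_lt (z : R * R) e : (`|z| < e) = (`|z.1| < e) && (`|z.2| < e).
Proof. by rewrite prod_normE gt_max. Qed.

Lemma pixelE z : `|z| <= M -> (pixel z).1 = cell z.1 :> nat /\ (pixel z).2 = cell z.2 :> nat.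
Proof.
rewrite prod_norm_le !ler_norml => /andP[z1 z2].
by rewrite !inordK // ltnS cell_le.
Qed.

Lemma corner_pixel z : `|z| <= M -> `|corner (pixel z) - z| <= mu.
Proof.
move=> zM; rewrite /corner; have [-> ->] := pixelE zM.
move: zM; rewrite !prod_norm_le /= !ler_norml => /andP[/andP[z1 _] /andP[z2 _]].
by move: (cell_itv z1) (cell_itv z2) => /andP[? ?] /andP[? ?]; apply/andP; split; apply/andP; split; lra.
Qed.

(** The two pixels differ by at most one in each coordinate, but perhaps in both, so the path turns
    at the pixel [m] with one coordinate from each. The corner of [m] is within [2 * mu] of [z],
    whence the radius. *)
Lemma pixel_step (N : {set grid n}) z w : `|z| <= M -> `|w| <= M -> `|z - w| < mu ->
  (forall p, `|corner p - z| <= 2 * mu -> p \in N) ->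
  (forall p, `|corner p - w| <= 2 * mu -> p \in N) ->
  connect (rel_inside (@grid_adj n) N) (pixel z) (pixel w).
Proof.
move=> zM wM zw nz nw.
have [pz1 pz2] := pixelE zM; have [pw1 pw2] := pixelE wM.
have cz := corner_pixel zM; have cw := corner_pixel wM.
have m0 := mu0.
have zin : pixel z \in N by apply: nz; apply: le_trans cz _; lra.
have win : pixel w \in N by apply: nw; apply: le_trans cw _; lra.
pose m : grid n := ((pixel w).1, (pixel z).2).
have min : m \in N.
  apply: nz; move: cz cw zw; rewrite prod_norm_lt !prod_norm_le /= !ltr_norml !ler_norml.
  by move=> /andP[/andP[? ?] /andP[? ?]] /andP[/andP[? ?] /andP[? ?]] /andP[/andP[? ?] /andP[? ?]];
    apply/andP; split; apply/andP; split; lra.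
move: zM wM zw; rewrite !prod_norm_le prod_norm_lt !ler_norml /=.
move=> /andP[/andP[a1 _] /andP[a2 _]] /andP[/andP[b1 _] /andP[b2 _]] /andP[d1 d2].
have c1 := cell_close a1 b1 d1; have c2 := cell_close a2 b2 d2.
rewrite distrC in d1; rewrite distrC in d2.
have c3 := cell_close b1 a1 d1; have c4 := cell_close b2 a2 d2.
apply: (@connect_trans _ _ m).
  have [->|ne] := eqVneq m (pixel z); first exact: connect0.
  apply: connect1; rewrite /rel_inside /= zin min !andbT /grid_adj /m /= eqxx /=.
  apply/orP; right; rewrite pz1 pw1; apply: next_to_close => //.
  by apply: contra ne => /eqP e; apply/eqP; rewrite /m [RHS]surjective_pairing; congr pair; apply: val_inj; rewrite /= pw1 pz1.
have [->|ne] := eqVneq m (pixel w); first exact: connect0.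
apply: connect1; rewrite /rel_inside /= win min !andbT /grid_adj /m /= eqxx /=.
apply/orP; left; rewrite pz2 pw2; apply: next_to_close => //.
by apply: contra ne => /eqP e; apply/eqP; rewrite /m [RHS]surjective_pairing; congr pair; apply: val_inj; rewrite /= pw2 pz2.
Qed.

Lemma pixel_chain (f : R -> R * R) b d (N : {set grid n}) : 0 < d ->
  (forall t, half b t -> `|f t| <= M) ->
  (forall s t, half b s -> half b t -> `|s - t| < d -> `|f s - f t| < mu) ->
  (forall p t, half b t -> `|corner p - f t| <= 2 * mu -> p \in N) ->
  forall s t, half b s -> half b t -> s <= t ->
  connect (rel_inside (@grid_adj n) N) (pixel (f s)) (pixel (f t)).
Proof.
move=> d0 fM fd fN.
have step s t : half b s -> half b t -> `|s - t| < d ->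
    connect (rel_inside (@grid_adj n) N) (pixel (f s)) (pixel (f t)).
  by move=> hs ht st; apply: pixel_step; [exact: fM | exact: fM | exact: fd | |] => p; apply: fN.
suff chain k : forall s t, half b s -> half b t -> s <= t -> t - s <= k%:R * (d / 2) ->
    connect (rel_inside (@grid_adj n) N) (pixel (f s)) (pixel (f t)).
  move=> s t hs ht st; apply: (chain (Num.truncn ((t - s) / (d / 2))).+1) => //.
  by rewrite -ler_pdivrMr ?divr_gt0 // ltW // truncnS_gt.
elim: k => [|k IH] s t hs ht st.
  rewrite mul0r => ts; have -> : s = t by lra.
  exact: connect0.
rewrite -natr1 mulrDl mul1r => le; have [tsd|tsd] := leP (t - s) (d / 2).
  by apply: step => //; rewrite ltr_norml; apply/andP; split; lra.
have hm : half b (s + d / 2) by apply: half_between hs ht _; apply/andP; split; lra.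
apply: (@connect_trans _ _ (pixel (f (s + d / 2)))).
  by apply: step => //; rewrite ltr_norml; apply/andP; split; lra.
by apply: IH => //; lra.
Qed.

End Cells.

(** * From a planar drawing to a grid model *)

Section GridModel.
Local Open Scope classical_set_scope.
Local Open Scope ring_scope.
Variables (R : realType) (G : sgraph).

Definition bpoint (b : bool) : R := if b then 1 else 0.

Lemma drawing_endpoints pos arc : plane_drawing (R := R) (G := G) pos arc ->
  exists endpoint : edge G -> bool -> G, forall A : edge G,
  [/\ forall b, arc A (bpoint b) = pos (endpoint A b), endpoint A false != endpoint A true
    & val A = finset.setU (finset.set1 (endpoint A false)) (finset.set1 (endpoint A true))].
Proof.
move=> [pos_inj _ arc_inj ends _ _].
suff ends_of A : exists ep : bool -> G, [/\ forall b, arc A (bpoint b) = pos (ep b),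
    ep false != ep true
    & val A = finset.setU (finset.set1 (ep false)) (finset.set1 (ep true))].
  by have [ep hep] := fin_all_exists ends_of; exists ep.
have end_of b : exists u, u \in val A /\ arc A (bpoint b) = pos u.
  have : (pos @` [set` val A]) (arc A (bpoint b)).
    by rewrite -ends; case: b; [right | left].
  by case=> u /= uA <-; exists u.
have [u [uA hu]] := end_of false; have [v [vA hv]] := end_of true.
have uv : u != v.
  apply/eqP => uv; have : arc A 0 = arc A 1 by move: hu hv; rewrite /bpoint uv => -> ->.
  by move/arc_inj; rewrite !in_itv /= !lexx ler01 => /(_ isT isT) /esym/eqP; rewrite oner_eq0.
exists (fun b => if b then v else u); split=> //; first by case.
have : val A \in edges G by apply: valP.
rewrite finset.inE => /existsP[x /existsP[y /andP[xy /eqP eA]]].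
apply/esym/eqP; rewrite eqEcard; apply/andP; split.
  by apply/fintype.subsetP => z; rewrite !finset.inE => /orP[/eqP ->|/eqP ->].
by rewrite eA !cards2 uv; case: (x != y).
Qed.

Lemma planar_grid_model : planar R G -> exists n (f : grid n -> option G),
  (forall x p q, f p = Some x -> f q = Some x ->
     connect (rel_inside (@grid_adj n) (finset (fun r => f r == Some x))) p q) /\
  (forall x y : G, x -- y -> exists p q, [/\ f p = Some x, f q = Some y & grid_adj p q]).
Proof.
move=> [pos [arc dr]]; have [endpoint hend] := drawing_endpoints dr.
case: dr => pos_inj arc_cont arc_inj _ arc_vertex arc_disj.
pose g A := arc A \o @clamp R.
have gE A t : 0 <= t <= 1 -> g A t = arc A t by move=> t01; rewrite /g /= clamp_id.
have cg A : continuous (g A) by apply: comp_clamp_continuous.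
have b01 b : 0 <= bpoint b <= 1 by case: b; rewrite /= lexx ler01.
have at_end A t w : 0 <= t <= 1 -> arc A t = pos w -> exists b, t = bpoint b.
  move=> /andP[t0 t1] atw; have [->|tn0] := eqVneq t 0; first by exists false.
  have [->|tn1] := eqVneq t 1; first by exists true.
  by case: (@arc_vertex A w t); rewrite // in_itv /= !lt_neqAle t0 t1 eq_sym tn0 tn1.
have half_end b b' : half b (bpoint b' : R) -> b = b'.
  by case: b; case: b' => //= /andP[]; lra.
(* Arcs of different edges meet at common ends only, and a half arc contains just one end. *)
have sep A B b b' : A != B -> endpoint A b != endpoint B b' ->
    forall s t, half b s -> half b' t -> g A s != g B t.
  move=> AB ne s t hs ht; have s01 := half_itv hs; have t01 := half_itv ht.
  rewrite !gE //; apply/eqP => eq.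
  have [[c sc]|sint] : (exists c, s = bpoint c) \/ s \in `]0, 1[.
    have [->|s0] := eqVneq s 0; first by left; exists false.
    have [->|s1] := eqVneq s 1; first by left; exists true.
    by right; rewrite in_itv /= !lt_neqAle eq_sym s0 s1.
    have [ac _ _] := hend A; rewrite sc ac in eq.
    have [c' tc'] := at_end B t _ t01 (esym eq).
    have [bc _ _] := hend B; rewrite tc' bc in eq.
    rewrite sc in hs; rewrite tc' in ht.
    by move: ne; rewrite (half_end _ _ hs) (half_end _ _ ht) (pos_inj _ _ eq) eqxx.
  have [tint|[c' tc']] : (t \in `]0, 1[) \/ (exists c, t = bpoint c).
    have [->|t0] := eqVneq t 0; first by right; exists false.
    have [->|t1] := eqVneq t 1; first by right; exists true.
    by left; rewrite in_itv /= !lt_neqAle eq_sym t0 t1.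
    exact: (arc_disj A B s t AB sint tint eq).
  by have [bc _ _] := hend B; rewrite tc' bc in eq; apply: (arc_vertex A _ s sint eq).
pose apart e (i : edge G * edge G * bool * bool) := let: (A, B, b, b') := i in
  A != B -> endpoint A b != endpoint B b' ->
  forall s t, half b s -> half b' t -> e <= `|g A s - g B t|.
have [||e1 e10 he1] := @finite_common_bound R _ (fun i e => apart e i).
- move=> [[[A B] b] b'] e e' he _ le' AB ne s t hs ht.
  by apply: le_trans le' _; apply: he.
- move=> [[[A B] b] b'] /=.
  have [AB|AB] := eqVneq A B; first by exists 1.
  have [E|ne] := eqVneq (endpoint A b) (endpoint B b'); first by exists 1.
  by have [e e0 he] := halves_separated (cg A) (cg B) (sep A B b b' AB ne); exists e.
have [||e2 e20 he2] := @finite_common_bound R _ (fun A e =>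
    forall t, half false t -> e <= `|g A t - pos (endpoint A true)| ).
- by move=> A e e' he _ le' t ht; apply: le_trans le' (he t ht).
- move=> A; have [ac _ _] := hend A.
  have [] := @halves_separated R (g A) (fun=> pos (endpoint A true)) false false (cg A).
  + by move=> t; apply: cvg_cst.
  + move=> s _ hs _; have s01 := half_itv hs; rewrite gE // -(ac true).
    apply/eqP => /arc_inj; rewrite !in_itv /= lexx ler01 s01 => /(_ isT isT) s1.
    by move: hs; rewrite s1 /= => /andP[_]; lra.
  + by move=> e e0 he; exists e => // t ht; apply: (he t t).
(* Pixels are within [2 * mu] of their half arc, so a common pixel would bring two half arcs within
   [4 * mu], less than [e1]. For the far end of an arc, [3 * mu] against [e2] suffices. *)
pose mu := Num.min e1 e2 / 5.
have mu0 : 0 < mu by rewrite divr_gt0 // lt_min e10.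
have mu5 : 5 * mu <= e1 /\ 5 * mu <= e2.
  by rewrite /mu mulrC divfK //; split; rewrite ge_min lexx ?orbT.
(* A common bound of all arcs is obtained through its inverse, as a sufficiently small positive
   number. *)
have [||M' M'0 hM'] := @finite_common_bound R _ (fun A e => forall t, 0 <= t <= 1 -> e * `|g A t| <= 1).
- move=> A e e' he e'0 le' t t01; apply: le_trans (he t t01); apply: ler_wpM2r => //.
- move=> A; have [M M0 hM] := bounded01 (cg A).
  by exists M^-1; [rewrite invr_gt0 | move=> t /hM; rewrite mulrC ler_pdivrMr // mul1r].
pose M := M'^-1.
have hM A t : 0 <= t <= 1 -> `|g A t| <= M.
  by move=> t01; rewrite /M -[_^-1]mul1r ler_pdivlMr // mulrC hM'.
have [||d d0 hd] := @finite_common_bound R _ (fun A e =>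
  forall s t, 0 <= s <= 1 -> 0 <= t <= 1 -> `|s - t| < e -> `|g A s - g A t| < mu).
- by move=> A e e' he _ le' s t s01 t01 lt; apply: he => //; apply: lt_le_trans lt le'.
- by move=> A; apply: uniformly_continuous01.
pose n := Num.truncn ((M + M) / mu).
pose N A b : {set grid n} := finset (fun p => `[< exists2 t, half b t & `|corner p - g A t| <= 2 * mu >]).
have pixN A b t p : half b t -> `|corner p - g A t| <= 2 * mu -> p \in N A b.
  by move=> ht hp; rewrite finset.inE; apply/asboolP; exists t.
have half0 : half false (0 : R) by apply/andP; split; lra.
have half1 : half true (1 : R) by apply/andP; split; lra.
have halfm b : half b (2^-1 : R) by case: b; apply/andP; split; lra.
have posE A b : pos (endpoint A b) = g A (bpoint b).
  by rewrite gE //; have [-> _ _] := hend A.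
have [||||f [fconn fadj]] := @branch_sets _ _ _ (@grid_adj n) endpoint N (fun w => pixel M mu (pos w)).
- exact: grid_adj_sym.
- move=> A; exists (pixel M mu (g A 2^-1)); rewrite !posE /=.
  have chain b := @pixel_chain R M mu mu0 (g A) b d (N A b) d0
    (fun t ht => hM A t (half_itv ht))
    (fun s t hs ht => hd A s t (half_itv hs) (half_itv ht)) (fun p t => pixN A b t p).
  split.
  + apply: (pixN A false 0) => //; apply: le_trans (corner_pixel mu0 _) _; last by lra.
    by apply: hM; rewrite lexx ler01.
  + by apply: chain => //; lra.
  + apply: (pixN A true 2^-1) => //; apply: le_trans (corner_pixel mu0 _) _; last by lra.
    exact: hM (half_itv (halfm true)).
  + by apply: chain => //; lra.
- move=> A; rewrite finset.inE; apply/asboolP => -[t ht].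
  have := he2 A t ht; rewrite posE.
  have cp := @corner_pixel R M mu mu0 (g A (bpoint true)) (hM _ _ (b01 true)).
  move=> far near; have [_ m2] := mu5.
  have := ler_distD (corner (pixel M mu (g A (bpoint true)))) (g A t) (g A (bpoint true)).
  by rewrite [`|g A t - corner _|]distrC; lra.
- move=> A B b b' AB ne; rewrite disjoint_subset; apply/fintype.subsetP => p.
  rewrite finset.inE => /asboolP[s hs ps]; apply/negP; rewrite finset.inE => /asboolP[t ht pt].
  have := he1 (A, B, b, b') AB ne s t hs ht; have [m1 _] := mu5.
  have := ler_distD (corner p) (g A s) (g B t).
  by rewrite [`|g A s - corner _|]distrC; lra.
exists n, f; split=> // x y xy.
have xyE : finset.setU (finset.set1 x) (finset.set1 y) \in edges G.
  by rewrite finset.inE; apply/existsP; exists x; apply/existsP; exists y; rewrite xy eqxx.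
pose A : edge G := exist (fun A => A \in edges G) _ xyE.
have [p [q [fp fq pq]]] := fadj A; have [_ ne eA] := hend A.
move: fp fq ne eA; set u := endpoint _ false; set v := endpoint _ true => fp fq ne /= eA.
have xin : x \in finset.setU (finset.set1 u) (finset.set1 v) by rewrite -eA finset.setU11.
have yin : y \in finset.setU (finset.set1 u) (finset.set1 v) by rewrite -eA !finset.inE eqxx orbT.
have nxy : x != y by apply: contraTneq xy => ->; rewrite adj_irr.
move: xin yin nxy; rewrite !finset.inE => /orP[]/eqP-> /orP[]/eqP->; rewrite ?eqxx // => _.
  by exists p, q.
by exists q, p; rewrite grid_adj_sym.
Qed.

End GridModel.

Theorem theorem20 (R : realType) (G : sgraph)
    (planarG : planar R G)
    (sigma_ge5 : 5 <= sigma G)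
    (sigma_geDelta : max_deg G + 2 <= sigma G)
    (girthG : girth_at_least G (girth_bound (sigma G))) :
  strong_chromatic_index G = sigma G.
Proof.
have [n [f [fibres edges_in]]] := planar_grid_model planarG.
have [|x y xy|x y _|c uc sc|e' sym' sub' nonempty'|g gP] :=
    @strong_colouring_exists G 'I_(sigma G) (@adj G) (@adj_sym G) (@adj_irr G);
  rewrite ?card_ord //.
- exact: deg_sigma.
- by apply: leq_trans sigma_geDelta; rewrite leq_add2r deg_le_max.
- by rewrite -girth_bound_spine //; apply: girthG.
- apply: (grid_faces sym' _ nonempty' fibres) => [x|x y /sub']; last exact: edges_in.
  by apply: contraFF (adj_irr x); apply: sub'.
apply: strong_chromatic_index_sigma.
exact: strongly_colorable_of (Ordinal (ltn_trans (isT : 0 < 4) sigma_ge5)) gP.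
Qed.
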